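(* For every outerplanar graph $G$ we have $\chi(G^{[\natural 3]})\le 10$, and there exists an outerplanar graph $G_4$ such that $\chi(G_4^{[\natural 3]})=5$.
   Context: All graphs are finite, undirected, simple and without loops. $\chi$ denotes the chromatic number. For a graph $G=(V,E)$ and a positive integer $p$, the exact distance-$p$ graph $G^{[\natural p]}$ has vertex set $V$, and $xy$ is an edge if and only if the distance between $x$ and $y$ in $G$ is exactly $p$. *)

(* Defs.v *)
From mathcomp Require Import all_boot all_order all_algebra.
From mathcomp Require Import all_classical all_reals all_analysis.

Set Implicit Arguments.
Unset Strict Implicit.
Unset Printing Implicit Defensive.

Import Order.TTheory GRing.Theory Num.Theory.
Import numFieldNormedType.Exports.

Local Open Scope classical_set_scope.
Local Open Scope ring_scope.

Record sgraph := SGraph {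
  vertex :> finType;
  edge : rel vertex;
  edge_sym : symmetric edge;
  edge_irrefl : irreflexive edge }.

Arguments edge {s}.

Definition proper_coloring (G : sgraph) (k : nat) (c : {ffun G -> 'I_k}) : bool :=
  [forall x : G, forall y : G, edge x y ==> (c x != c y)].

Definition colorable (G : sgraph) (k : nat) : bool :=
  [exists c : {ffun G -> 'I_k}, proper_coloring c].

Lemma colorable_exists (G : sgraph) : exists k, colorable G k.
Proof.
exists #|G|; apply/existsP; exists [ffun x => enum_rank x].
apply/forallP => x; apply/forallP => y; apply/implyP => xy.
rewrite !ffunE (inj_eq enum_rank_inj); apply: contraTneq xy => ->.
by rewrite edge_irrefl.
Qed.

Definition chromatic_number (G : sgraph) : nat := ex_minn (colorable_exists G).

Definition walk (G : sgraph) (n : nat) (x y : G) : bool :=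
  [exists s : n.-tuple G, path edge x s && (last x s == y)].

(* The distance from x to y is n; false for all n when x and y lie in
   different components. *)
Definition at_distance (G : sgraph) (n : nat) (x y : G) : bool :=
  walk n x y && [forall m : 'I_n, ~~ walk m x y].

Lemma walk_sym (G : sgraph) (n : nat) : symmetric (@walk G n).
Proof.
have W (x y : G) : walk n x y -> walk n y x.
  move=> /existsP[s /andP[ps /eqP sy]]; apply/existsP.
  have sz : size (rev (belast x s)) == n by rewrite size_rev size_belast size_tuple.
  exists (Tuple sz) => /=; rewrite -sy.
  have -> : path edge (last x s) (rev (belast x s)) = path edge x s.
    by rewrite rev_path; apply: eq_path => a b; rewrite edge_sym.
  rewrite ps /=; case: (tval s) => //= a t.
  by rewrite rev_cons last_rcons.
by move=> x y; apply/idP/idP; apply: W.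
Qed.

Lemma at_distance_sym (G : sgraph) (n : nat) : symmetric (@at_distance G n).
Proof.
move=> x y; rewrite /at_distance walk_sym; congr (_ && _).
by apply: eq_forallb => m; rewrite walk_sym.
Qed.

Lemma at_distance_irrefl (G : sgraph) (n : nat) :
  (0 < n)%N -> irreflexive (@at_distance G n).
Proof.
move=> n0 x; apply/negP => /andP[_ /forallP/(_ (Ordinal n0))/negP]; apply.
by apply/existsP; exists [tuple]; rewrite /= eqxx.
Qed.

Definition exact_distance_graph (G : sgraph) (p : nat) (p_gt0 : (0 < p)%N) : sgraph :=
  SGraph (@at_distance_sym G p) (@at_distance_irrefl G p p_gt0).

Arguments exact_distance_graph : clear implicits.

(* Plane drawings.  The norm of R * R is the sup norm, which induces the usual
   topology and the usual bounded sets. *)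
Definition is_arc (R : realType) (A : set (R * R)) (p q : R * R) : Prop :=
  exists f : R -> R * R,
    [/\ {within `[0, 1], continuous f},
        {in `[0, 1] &, injective f},
        f 0 = p, f 1 = q & A = f @` `[0, 1]].

(* An edge is presented by its two orientations, so its arc is indexed by an
   ordered pair; arc_sym makes both orientations denote the same arc.  The value
   of arc on non-adjacent pairs is irrelevant. *)
Record drawing (R : realType) (G : sgraph) := Drawing {
  vpoint : G -> R * R;
  arc : G -> G -> set (R * R);
  vpoint_inj : injective vpoint;
  arcP : forall x y, edge x y -> is_arc (arc x y) (vpoint x) (vpoint y);
  arc_sym : forall x y, edge x y -> arc x y = arc y x;
  arc_vpoint : forall x y z, edge x y -> arc x y (vpoint z) -> z = x \/ z = y;
  arc_disjoint : forall x y u v, edge x y -> edge u v ->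
    ~ (x = u /\ y = v) -> ~ (x = v /\ y = u) ->
    arc x y `&` arc u v `<=` range vpoint }.

Definition drawing_support (R : realType) (G : sgraph) (d : drawing R G) : set (R * R) :=
  range (vpoint d) `|` [set p | exists x y, edge x y /\ arc d x y p].

(* The complement of the (compact) support has exactly one unbounded connected
   component; connected_component A p is empty when p is not in A. *)
Definition outer_face (R : realType) (G : sgraph) (d : drawing R G) : set (R * R) :=
  [set p | ~ bounded_set (connected_component (~` drawing_support d) p)].

Definition boundary (T : topologicalType) (A : set T) : set T :=
  closure A `\` interior A.

Definition outerplanar (R : realType) (G : sgraph) : Prop :=
  exists d : drawing R G, forall x : G, boundary (outer_face d) (vpoint d x).

(* Main.v *)
Require Import Defs.
From mathcomp Require Import all_boot all_order all_algebra.
From mathcomp Require Import all_classical all_reals all_analysis.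
From mathcomp Require Import zify lra.
From Stdlib Require Import Ring.

Set Implicit Arguments.
Unset Strict Implicit.
Unset Printing Implicit Defensive.

(** Upper bound.  An outerplane graph has no K_{2,3} minor: an additional point of
    the outer face, joined to the three vertices of the other side, would complete
    a K_{3,3} minor, which the van Kampen obstruction (parity of the independent
    crossings) excludes.  Split each component into layers by distance from a root.
    A component of the layers >= k then has at most two neighbours in layer k - 1,
    and contracting these components turns layer k - 1 into a disjoint union of
    paths and triangles.  Colour x by the colour of a canonical parent f(x).  If x, y
    are at distance 3 then f(x) <> f(y), and for fixed u = f(x), among the v = f(y)
    preceding u, at most 2 + 2 + 3 + 2 lie 3, 2, 1, 0 layers below u: greedy
    colouring needs 10 colours.

    Lower bound.  Four rounds of adding a triangle on every outer edge, starting
    from a triangle, give an outerplanar graph that contains a suitable graph on 23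
    vertices; its vertices are put on a parabola in cyclic order. *)

(** * Connectivity and distances *)

(** Colouring parents instead of vertices is forced. In a double star the leaves of one centre are
    at distance three from all leaves of the other, so the exact distance-3 graph contains
    arbitrarily large complete bipartite graphs and no ordering of the vertices bounds the number of
    earlier neighbours; passing to parents collapses siblings.

    The counts arise as follows. Two or three layers below [u], a candidate is a boundary vertex of
    the component of [u] in the layers above it. In the two nearer layers, candidates are only
    linked to such vertices, or to [u], by short walks in the contracted layer; its linear structure
    confines them to a window of consecutive positions. Taking the parent of least position shortens
    each window by one: three candidates instead of four one layer below, two instead of three in
    the layer of [u].

    Arcs are merely continuous and may meet a line infinitely often. Parities are therefore defined
    for chains of small steps inside compact sets, and disjoint compact sets keep a positive
    distance. *)

Section Connectivity.
Variables (T : Type) (E : T -> T -> Prop).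

Inductive conn (S : T -> Prop) (x : T) : T -> Prop :=
| conn_refl : S x -> conn S x x
| conn_step y z : conn S x y -> E y z -> S z -> conn S x z.

Lemma conn_memr S x y : conn S x y -> S y.
Proof. by case. Qed.

Lemma conn_meml S x y : conn S x y -> S x.
Proof. by elim. Qed.

Lemma conn_trans S x y z : conn S x y -> conn S y z -> conn S x z.
Proof. by move=> xy; elim=> [_ //|u v _ xu uv Sv]; exact: (conn_step xu uv Sv). Qed.

Lemma conn_edge (S : T -> Prop) x y : S x -> S y -> E x y -> conn S x y.
Proof. by move=> Sx Sy xy; apply: conn_step xy Sy; exact: conn_refl. Qed.

(** Only vertices reached from [x] are tested, so [S'] may be the component of [x] itself; this is
    how components are shown to be connected. *)
Lemma conn_sub (S S' : T -> Prop) x y :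
  (forall z, conn S x z -> S' z) -> conn S x y -> conn S' x y.
Proof.
move=> SS'; elim=> [Sx|u v xu xu' uv Sv].
  by apply: conn_refl; apply: SS'; exact: conn_refl.
by apply: (conn_step xu' uv); apply: SS'; exact: (conn_step xu uv Sv).
Qed.

Hypothesis Esym : forall x y, E x y -> E y x.

Lemma conn_sym S x y : conn S x y -> conn S y x.
Proof.
elim=> [|u v xu ux uv Sv]; first exact: conn_refl.
by apply: conn_trans ux; apply: conn_edge (Esym uv) => //; exact: conn_memr xu.
Qed.

End Connectivity.

Section Distance.
Variables (T : finType) (E : T -> T -> Prop).

Fixpoint steps (b : T) (n : nat) (z : T) : Prop :=
  if n is m.+1 then exists2 y, steps b m y & E y z else z = b.

Definition reach (b z : T) : Prop := exists n, `[< steps b n z >].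

Definition dist (b z : T) : nat :=
  if pselect (reach b z) is left h then ex_minn h else 0.

Lemma dist_steps b z : reach b z -> steps b (dist b z) z.
Proof.
by rewrite /dist; case: pselect => // h _; case: ex_minnP => n /asboolP.
Qed.

Lemma reach_steps b n z : steps b n z -> reach b z.
Proof. by move=> h; exists n; apply/asboolP. Qed.

Lemma dist_le b n z : steps b n z -> dist b z <= n.
Proof.
move=> h; rewrite /dist; case: pselect => // h'.
by case: ex_minnP => m _; apply; apply/asboolP.
Qed.

Lemma reach_refl b : reach b b.
Proof. exact: (@reach_steps _ 0). Qed.

Lemma reach_edge b y z : reach b y -> E y z -> reach b z.
Proof. by move=> [n /asboolP by_] yz; apply: (@reach_steps _ n.+1); exists y. Qed.

Lemma reach_trans a b z : reach a b -> reach b z -> reach a z.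
Proof.
move=> ab [n /asboolP]; elim: n z => [|n IH] z /=; first by move=> ->.
by move=> [y /IH ay yz]; exact: reach_edge ay yz.
Qed.

Lemma dist_refl b : dist b b = 0.
Proof. by apply/eqP; rewrite -leqn0; exact: (@dist_le _ 0). Qed.

Lemma dist_eq0 b z : reach b z -> dist b z = 0 -> z = b.
Proof. by move=> /dist_steps; case: dist. Qed.

Lemma dist_edge b y z : reach b y -> E y z -> dist b z <= (dist b y).+1.
Proof. by move=> /dist_steps h yz; apply: dist_le; exists y. Qed.

Lemma dist_pred b z n : reach b z -> dist b z = n.+1 ->
  exists y, [/\ reach b y, E y z & dist b y = n].
Proof.
move=> bz dz; have := dist_steps bz; rewrite dz => -[y sy yz].
have ry := reach_steps sy.
exists y; split=> //; apply/eqP; rewrite eqn_leq dist_le //=.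
by rewrite -ltnS -dz dist_edge.
Qed.

Hypothesis Esym : forall x y, E x y -> E y x.

Lemma reach_sym x y : reach x y -> reach y x.
Proof.
move=> [n /asboolP]; elim: n y => [|n IH] y /=.
  by move=> ->; exact: reach_refl.
move=> [z /IH zx zy]; apply: reach_trans zx.
exact: reach_edge (reach_refl y) (Esym zy).
Qed.

Hypothesis deg2 : forall x a b c, E x a -> E x b -> E x c ->
  [\/ a = b, a = c | b = c].

(* Starting from a vertex of degree at most one, each distance level is a
   singleton, so the component is a path traversed by the distance. *)
Lemma dist_inj b z z' : (forall a c, E b a -> E b c -> a = c) ->
  reach b z -> reach b z' -> dist b z = dist b z' -> z = z'.
Proof.
move=> deg1; move dn: (dist b z) => n.
elim/ltn_ind: n z z' dn => -[|[|n]] IH z z' dz bz bz' dz'.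
- by rewrite (dist_eq0 bz dz) (dist_eq0 bz').
- have [y [ry yz /dist_eq0 yb]] := dist_pred bz dz.
  have [y' [ry' yz' /dist_eq0 yb']] := dist_pred bz' (esym dz').
  by apply: deg1; [rewrite -(yb ry)|rewrite -(yb' ry')].
have [y [ry yz dy]] := dist_pred bz dz.
have [y' [ry' yz' dy']] := dist_pred bz' (esym dz').
have yy' : y = y' by apply: (IH n.+1) => //; rewrite dy'.
have [x [rx xy dx]] := dist_pred ry dy; subst y'.
have [] := deg2 (Esym xy) yz yz' => // xE; subst x; lia.
Qed.

End Distance.

Section Root.
Variables (T : finType) (E : T -> T -> Prop).
Hypothesis Esym : forall x y, E x y -> E y x.

(** [pick] depends only on the extension of its predicate, so a whole component shares one
    representative, the later root of its layers. *)
Definition rep (x : T) : T := odflt x [pick y | `[< reach E x y >]].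

Lemma rep_reach x : reach E x (rep x).
Proof.
rewrite /rep; case: pickP => [y /asboolP//|_ /=]; exact: reach_refl.
Qed.

Lemma rep_eq x y : reach E x y -> rep x = rep y.
Proof.
move=> xy; rewrite /rep.
have -> : [pick z | `[< reach E x z >]] = [pick z | `[< reach E y z >]].
  apply: eq_pick => z; apply: asbool_equiv_eq; split; apply: reach_trans => //.
  exact: reach_sym.
case: pickP => // /(_ y) /asboolP[]; exact: reach_refl.
Qed.

Lemma rep_rep x : rep (rep x) = rep x.
Proof. by apply/esym/rep_eq/rep_reach. Qed.

End Root.

(** * Positions in disjoint unions of paths and triangles *)

Section LinearForest.
Variables (T : finType) (E : T -> T -> Prop).
Hypothesis Esym : forall x y, E x y -> E y x.
Hypothesis Eirr : forall x, ~ E x x.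
Hypothesis deg2 : forall x a b c, E x a -> E x b -> E x c ->
  [\/ a = b, a = c | b = c].
(** Excludes cycles of length at least four, cut at two non-consecutive vertices [w], [w'] into arcs
    [A], [A']. The arcs need only be connected, as branch sets of a minor are. *)
Hypothesis no_long_cycle : forall (w w' : T) (A A' : T -> Prop),
  w <> w' -> (forall z, A z -> [/\ z <> w, z <> w' & ~ A' z]) ->
  (forall z, A' z -> z <> w /\ z <> w') ->
  (forall x y, A x -> A y -> conn E A x y) ->
  (forall x y, A' x -> A' y -> conn E A' x y) ->
  (exists2 a, A a & E w a) -> (exists2 a, A a & E w' a) ->
  (exists2 a, A' a & E w a) -> (exists2 a, A' a & E w' a) -> False.

Definition end_vertex (b : T) : Prop := forall a c, E b a -> E b c -> a = c.

Lemma not_end_vertex b : ~ end_vertex b -> exists a c, [/\ E b a, E b c & a <> c].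
Proof.
move=> nb; apply: contrapT => h; apply: nb => a c ba bc.
by apply: contrapT => ac; apply: h; exists a, c.
Qed.

(** Without end vertices the component is a cycle: removing [x] leaves a path from a neighbour [v],
    whose last vertex must be adjacent to [x]. *)
Lemma endless_component_card x :
  (forall b, reach E x b -> ~ end_vertex b) ->
  #|[pred z | `[< reach E x z >]]| <= 3.
Proof.
move=> noend; have [v [v' [xv xv' vv']]] := not_end_vertex (noend x (reach_refl _ _)).
(* [g] is the graph without [x]. In it [v] has at most one neighbour, so by [dist_inj] the distance
   [d] from [v] numbers its component injectively. *)
pose g p q := [/\ E p q, p <> x & q <> x].
have gsym p q : g p q -> g q p by case=> /Esym.
have gdeg2 p a b c : g p a -> g p b -> g p c -> [\/ a = b, a = c | b = c].
  by move=> [? _ _] [? _ _] [? _ _]; exact: (@deg2 p).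
have vNx : v <> x by move=> vx; apply: (Eirr (x := x)); rewrite -{2}vx.
have gend a c : g v a -> g v c -> a = c.
  move=> [va _ ax] [vc _ cx].
  by have [|?|?|//] := @deg2 v x a c _ va vc; [exact: Esym|subst..].
pose d := dist g v.
have dinj z z' : reach g v z -> reach g v z' -> d z = d z' -> z = z'.
  exact: dist_inj.
have KNx z : reach g v z -> z <> x.
  by move=> /dist_steps; case: dist => [->//|n [y _ []]].
have Kv : `[< reach g v v >] by apply/asboolP; exact: reach_refl.
case: (arg_maxnP (P := fun z => `[< reach g v z >]) d Kv) => m /asboolP Km mmax.
have {}mmax z : reach g v z -> d z <= d m by move=> /asboolP/mmax.
have Kx z : reach g v z -> reach E x z.
  move=> [n /asboolP]; elim: n z => [|n IH] z /=.
    by move=> ->; exact: reach_edge (reach_refl _ _) xv.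
  by move=> [y /IH xy [yz _ _]]; exact: reach_edge xy yz.
(* [m] is farthest from [v], so a neighbour other than [x] can only be the unique vertex one step
   before it; the second neighbour of [m] must be [x]. *)
have mnbr a : E m a -> a <> x -> reach g v a /\ (d a).+1 = d m.
  move=> ma ax; have gma : g m a by split=> //; exact: KNx.
  have Ka := reach_edge Km gma; split=> //.
  have := mmax _ Ka; have := dist_edge Ka (gsym _ _ gma).
  have : d a <> d m.
    by move=> /(dinj _ _ Ka Km) am; subst a; exact: Eirr ma.
  rewrite -/d; lia.
have [xm [y [Ky my dy]]] : E x m /\ exists y, [/\ reach g v y, E m y & (d y).+1 = d m].
  have [a [c [ma mc ac]]] : exists a c, [/\ E m a, E m c & a <> c].
    exact/not_end_vertex/noend/Kx.
  have [ax|ax] := pselect (a = x); have [cx|cx] := pselect (c = x).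
  - by subst.
  - have [Kc dc] := mnbr c mc cx; subst a.
    by split; [exact: Esym|exists c].
  - have [Ka da] := mnbr a ma ax; subst c.
    by split; [exact: Esym|exists a].
  have [Ka da] := mnbr a ma ax; have [Kc dc] := mnbr c mc cx.
  by case: ac; apply: dinj => //; lia.
have d0 : d v = 0 by exact: dist_refl.
have cover z : reach E x z -> z = x \/ reach g v z.
  move=> [n /asboolP]; elim: n z => [|n IH] z /=; first by left.
  move=> [u /IH[->|Ku] uz].
    right; have [vm|<-|<-//] := @deg2 x v m z xv xm uz; last exact: reach_refl.
    by move: dy; rewrite -vm d0.
  case: (pselect (z = x)) => [->|zx]; first by left.
  by right; apply: (reach_edge Ku); split=> //; exact: KNx.
have [dm|dm] := leqP (d m) 1.
  have : {subset [pred z | `[< reach E x z >]] <= [:: x; v; m]}.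
    move=> z; rewrite !inE => /cover[->|Kz]; first by rewrite eqxx.
    have [dz|dz] := leqP (d z) 0.
      by rewrite (@dinj z v) ?eqxx ?orbT //; [exact: reach_refl|lia].
    by rewrite (@dinj z m) ?eqxx ?orbT //; have := mmax _ Kz; lia.
  by move=> /fintype.subsetP/subset_leq_card/leq_trans; apply; exact: card_size.
have lev k z : reach g v z -> k <= d z -> exists u, reach g v u /\ d u = k.
  move dzn: (d z) => n; elim: n z dzn => [|n IH] z dz Kz kz.
    by exists z; split=> //; lia.
  have [->|kn] := eqVneq k n.+1; first by exists z.
  by have [u [Ku _ du]] := dist_pred Kz dz; apply: (IH u) => //; lia.
have [x2 [K2 d2]] := lev 2 m Km dm.
have [x1 [K1 [e12 _ _] d1]] := dist_pred K2 d2.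
have [x0 [K0 [e01 _ _] /(dist_eq0 K0) x0v]] := dist_pred K1 d1.
rewrite -/d in d1; subst x0.
(* The cycle begins [x], [v], [x1], [x2]. Cut at [x] and [x1], its arcs are [v] alone and the
   vertices at distance at least 2 from [v]. *)
case: (@no_long_cycle x x1 (eq v) (fun z => reach g v z /\ 2 <= d z)).
- by move=> xx1; apply: (KNx _ K1).
- move=> z <-; split=> //; [|by case; rewrite d0].
  by move=> vx1; move: d1; rewrite -vx1 d0.
- by move=> z [Kz dz]; split; [exact: KNx|move=> zx1; move: dz; rewrite zx1 d1].
- by move=> a b <- <-; exact: conn_refl.
- have c2 z : reach g v z /\ 2 <= d z -> conn E (fun z => reach g v z /\ 2 <= d z) x2 z.
    move=> [Kz]; move dzn: (d z) => n; elim: n z Kz dzn => // n IH z Kz dz n1.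
    have [n2|n2] := eqVneq n 1.
      have -> : z = x2 by apply: dinj => //; rewrite dz n2.
      by apply: conn_refl; split=> //; rewrite d2.
    have [u [Ku [uz _ _] du]] := dist_pred Kz dz.
    by apply: (@conn_step _ _ _ _ u) => //; [apply: IH => //; lia|rewrite dz].
  move=> a b /c2 xa /c2; apply: conn_trans; exact: conn_sym.
- by exists v.
- by exists v => //; exact: Esym.
- by exists m.
- by exists x2 => //; split=> //; rewrite d2.
Qed.

Definition comp_end (x : T) : option T :=
  [pick b | `[< reach E (rep E x) b /\ end_vertex b >]].

(* A component without end vertex is a triangle: only [pos x <= 2] matters there. *)
Definition pos (x : T) : nat :=
  if comp_end x is Some b then dist E b x
  else index x (enum [pred z | `[< reach E (rep E x) z >]]).

Lemma pos_inj x y : reach E x y -> pos x = pos y -> x = y.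
Proof.
move=> xy; rewrite /pos /comp_end -(rep_eq Esym xy).
have rx : reach E (rep E x) x by apply/(reach_sym Esym)/rep_reach.
have ry := reach_trans rx xy.
case: pickP => [b /asboolP[rb eb]|_].
  have br := reach_sym Esym rb.
  by apply: dist_inj => //; exact: reach_trans br _.
move=> ixy; rewrite -(nth_index x (_ : x \in enum [pred z | `[< reach E (rep E x) z >]])).
  by rewrite ixy nth_index // mem_enum inE.
by rewrite mem_enum inE.
Qed.

(** The second case covers triangles: an edge may join positions 0 and 2, but positions up to 2
    never differ by more than 2, which is all that the later counts tolerate. *)
Lemma pos_edge x y : E x y ->
  pos y <= (pos x).+1 \/ (forall z, reach E x z -> pos z <= 2).
Proof.
move=> xy; have rxy := reach_edge (reach_refl E x) xy.
have rx : reach E (rep E x) x by apply/(reach_sym Esym)/rep_reach.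
rewrite /pos /comp_end -(rep_eq Esym rxy).
case: pickP => [b /asboolP[rb eb]|noend].
  left; apply: dist_edge => //.
  by apply: reach_trans rx; exact: reach_sym.
right=> z xz; rewrite -(rep_eq Esym xz).
case: pickP => [b|_]; first by rewrite noend.
have zc : z \in enum [pred z | `[< reach E (rep E x) z >]].
  by rewrite mem_enum inE; exact: reach_trans rx xz.
rewrite -ltnS; rewrite -index_mem in zc; apply: leq_trans zc _.
rewrite -cardE; apply: endless_component_card => b rb eb.
by have /asboolP := noend b; apply.
Qed.

End LinearForest.

(** * Breadth-first layers in graphs without K_{2,3} minor *)

Section Minor.
Variables (T : Type) (E : T -> T -> Prop).

Definition connected_in (S : T -> Prop) : Prop :=
  forall x y, S x -> S y -> conn E S x y.

Definition touches (A B : T -> Prop) : Prop :=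
  exists x y, [/\ A x, B y & E x y].

(** The minor is given by its branch sets; [touches] makes them nonempty. *)
Definition K23_minor_free : Prop :=
  forall (P Q : T -> Prop) (A : 'I_3 -> T -> Prop),
  connected_in P -> connected_in Q -> (forall i, connected_in (A i)) ->
  (forall x, P x -> ~ Q x) ->
  (forall i x, A i x -> ~ P x /\ ~ Q x) ->
  (forall i j x, A i x -> A j x -> i = j) ->
  (forall i, touches P (A i)) -> (forall i, touches Q (A i)) -> False.

Lemma K23_minor_free_sets : K23_minor_free ->
  forall P Q A0 A1 A2 : T -> Prop,
  connected_in P -> connected_in Q ->
  connected_in A0 -> connected_in A1 -> connected_in A2 ->
  (forall x, P x -> ~ Q x) ->
  (forall x, A0 x -> [/\ ~ P x, ~ Q x, ~ A1 x & ~ A2 x]) ->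
  (forall x, A1 x -> [/\ ~ P x, ~ Q x & ~ A2 x]) ->
  (forall x, A2 x -> ~ P x /\ ~ Q x) ->
  touches P A0 -> touches P A1 -> touches P A2 ->
  touches Q A0 -> touches Q A1 -> touches Q A2 -> False.
Proof.
move=> mf P Q A0 A1 A2 cP cQ c0 c1 c2 PQ d0 d1 d2 P0 P1 P2 Q0 Q1 Q2.
pose A (i : 'I_3) : T -> Prop :=
  match val i with 0 => A0 | 1 => A1 | _ => A2 end.
apply: (mf P Q A) => //.
- by case=> [[|[|[|]]]].
- case=> [[|[|[|]]]] lt_i x; rewrite ?/A /= => Ax //.
  + by case: (d0 x Ax).
  + by case: (d1 x Ax).
  + exact: d2.
- case=> [[|[|[|]]]] // ? [[|[|[|]]]] // ? x;
    rewrite /A /= => ax bx; try exact: val_inj.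
  + by case: (d0 x ax).
  + by case: (d0 x ax).
  + by case: (d0 x bx).
  + by case: (d1 x ax).
  + by case: (d0 x bx).
  + by case: (d1 x bx).
- by case=> [[|[|[|]]]].
- by case=> [[|[|[|]]]].
Qed.

End Minor.

Section Layers.
Variables (T : finType) (E : T -> T -> Prop).
Hypothesis Esym : forall x y, E x y -> E y x.
Hypothesis Eirr : forall x, ~ E x x.
Hypothesis K23 : K23_minor_free E.

Definition layer (x : T) : nat := dist E (rep E x) x.

Lemma rep_edge x y : E x y -> rep E x = rep E y.
Proof. by move=> xy; apply/(rep_eq Esym)/(reach_edge (reach_refl E x)). Qed.

Lemma reach_rep x : reach E (rep E x) x.
Proof. exact/(reach_sym Esym)/rep_reach. Qed.

Lemma layer_edge x y : E x y -> layer y <= (layer x).+1.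
Proof.
by move=> xy; rewrite /layer -(rep_edge xy); apply: dist_edge xy; exact: reach_rep.
Qed.

Lemma layer_eq0 x : layer x = 0 -> x = rep E x.
Proof. by apply: dist_eq0; exact: reach_rep. Qed.

Lemma layer_pred x n : layer x = n.+1 -> exists2 y, E y x & layer y = n.
Proof.
move=> /(dist_pred (reach_rep x))[y [ry yx dy]].
by exists y => //; rewrite /layer (rep_edge yx).
Qed.

Lemma lower_conn k x : layer x <= k -> conn E (fun z => layer z <= k) (rep E x) x.
Proof.
move lx: (layer x) => n; elim: n x lx => [|n IH] x lx nk.
  by rewrite -layer_eq0 //; apply: conn_refl; rewrite lx.
have [y yx ly] := layer_pred lx.
rewrite -(rep_edge yx); apply: (conn_step _ yx); last by rewrite lx.
by apply: IH => //; exact: ltnW.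
Qed.

Definition lower (i : nat) (r x : T) : Prop := layer x < i /\ rep E x = r.

Lemma lower_connected i r : connected_in E (lower i r).
Proof.
case: i => [|i] x y [lx rx] [ly ry] //.
have c z : lower i.+1 r z -> conn E (lower i.+1 r) r z.
  case=> lz <-; apply: conn_sub (lower_conn lz) => u zu; split.
    exact: conn_memr zu.
  rewrite -(rep_rep Esym z); elim: zu => // a b _ <- ab _; exact/esym/rep_edge.
by apply: conn_trans (c y _) => //; apply: conn_sym => //; exact: c.
Qed.

Definition upper (k : nat) : T -> T -> Prop := conn E (fun z => k <= layer z).

(** [w] lies one layer under the level [k]. Writing [(layer w).+1 = k] leaves level 0 without
    boundary vertices, which later absorbs truncated subtractions. *)
Definition boundary_vertex (k : nat) (x w : T) : Prop :=
  (layer w).+1 = k /\ exists2 z, upper k x z & E z w.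

Lemma upper_rep k x y : upper k x y -> rep E x = rep E y.
Proof. by elim=> // a b _ -> ab _; exact: rep_edge. Qed.

Lemma boundary_rep k x w : boundary_vertex k x w -> rep E w = rep E x.
Proof. by case=> _ [z xz /rep_edge <-]; rewrite (upper_rep xz). Qed.

Lemma boundary_upper k x y w :
  upper k x y -> boundary_vertex k x w -> boundary_vertex k y w.
Proof.
move=> xy [lw [z xz zw]]; split=> //; exists z => //.
by apply: conn_trans xz; exact: conn_sym.
Qed.

Lemma boundary_layer k x w : boundary_vertex k x w -> k <= layer x.
Proof. by case=> _ [z xz _]; exact: conn_meml xz. Qed.

Lemma boundary_ex k x : k < layer x -> exists w, boundary_vertex k.+1 x w.
Proof.
move lx: (layer x) => n; elim: n x lx => // n IH x lx; rewrite ltnS => kn.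
have [y yx ly] := layer_pred lx.
have [kE|nk] := eqVneq k n.
  exists y; split; first by rewrite ly kE.
  by exists x; [apply: conn_refl; rewrite lx kE|exact: Esym].
have kn' : k < n by rewrite ltn_neqAle nk.
have [w wb] := IH y ly kn'; exists w; apply: boundary_upper wb.
by apply: conn_edge yx; rewrite ?lx ?ly // ltnW.
Qed.

(* Three boundary vertices would form a K_{2,3} minor whose hubs are the upper
   component and the layers [< k - 1]. *)
Lemma boundary_le2 k x a b c :
  boundary_vertex k x a -> boundary_vertex k x b -> boundary_vertex k x c ->
  [\/ a = b, a = c | b = c].
Proof.
move=> ba bb bc; apply: contrapT => abc.
have nab : a <> b by move=> ab; apply: abc; constructor 1.
have nac : a <> c by move=> ac; apply: abc; constructor 2.
have nbc : b <> c by move=> bc'; apply: abc; constructor 3.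
have ra := boundary_rep ba; have rb := boundary_rep bb; have rc := boundary_rep bc.
move: (ba) (bb) (bc) => [la _] [lb _] [lc _].
case: k => [//|k] in ba bb bc la lb lc *.
case: la => la; case: lb => lb; case: lc => lc.
have par w : layer w = k -> rep E w = rep E x -> touches E (lower k (rep E x)) (eq w).
  (* Layer 0 of a component is its root alone, so here [a] and [b] would coincide. *)
  case: k => [|k] in ba bb bc la lb lc * => lw rw.
    by case: nab; rewrite (layer_eq0 la) (layer_eq0 lb) ra rb.
  have [y yw ly] := layer_pred lw; exists y, w; split=> //; split; first by rewrite ly.
  by rewrite (rep_edge yw).
have up w : boundary_vertex k.+1 x w -> touches E (upper k.+1 x) (eq w).
  by case=> _ [z xz zw]; exists z, w.
have single w : connected_in E (eq w).
  by move=> u v <- <-; exact: conn_refl.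
have ul y : upper k.+1 x y -> k.+1 <= layer y by exact: conn_memr.
have one w : layer w = k -> ~ lower k (rep E x) w /\ ~ upper k.+1 x w.
  by move=> lw; split; [move=> []|move=> /ul]; lia.
apply: (@K23_minor_free_sets _ _ K23 (lower k (rep E x)) (upper k.+1 x) (eq a) (eq b) (eq c)).
- exact: lower_connected.
- move=> y z xy xz.
  have : conn E (fun u => k < layer u) y z.
    by apply: conn_trans xz; exact: conn_sym.
  apply: conn_sub => u yu; exact: conn_trans yu.
- exact: single.
- exact: single.
- exact: single.
- by move=> y [ly _] /ul; lia.
- by move=> y <-; have [? ?] := one a la; split=> // /esym.
- by move=> y <-; have [? ?] := one b lb; split=> // /esym.
- by move=> y <-; exact: one.
- exact: par.
- exact: par.
- exact: par.
- exact: up.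
- exact: up.
- exact: up.
Qed.

(* The graph induced on a layer by contracting what lies above it. *)
Definition shadow (w w' : T) : Prop :=
  [/\ layer w = layer w', w <> w' & E w w' \/ exists x,
    boundary_vertex (layer w).+1 x w /\ boundary_vertex (layer w).+1 x w'].

Lemma shadow_sym w w' : shadow w w' -> shadow w' w.
Proof.
case=> lw ww' h; split=> //; first by move=> /esym.
by rewrite -lw; case: h => [/Esym|[x []]]; [left|right; exists x].
Qed.

Lemma shadow_rep w w' : shadow w w' -> rep E w = rep E w'.
Proof.
by case=> _ _ [/rep_edge//|[x [/boundary_rep-> /boundary_rep->]]].
Qed.

Lemma shadow_layer_gt0 w w' : shadow w w' -> 0 < layer w.
Proof.
move=> ww'; have := shadow_rep ww'; case: ww' => lw nw _ rw.
rewrite lt0n; apply/eqP => l0; apply: nw.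
by rewrite (layer_eq0 l0) rw -layer_eq0 // -lw.
Qed.

(* [X] together with the upper components that attach to [X], and otherwise
   only to [F]. *)
Definition thicken (i : nat) (X F : T -> Prop) (z : T) : Prop :=
  X z \/ (exists2 w, X w & boundary_vertex i.+1 z w) /\
         (forall w, boundary_vertex i.+1 z w -> X w \/ F w).

Lemma thicken_layer i (X F : T -> Prop) z : (forall w, X w -> layer w = i) ->
  thicken i X F z -> (layer z = i /\ X z) \/ i < layer z.
Proof.
by move=> Xi [Xz|[[w _ /boundary_layer lz] _]]; [left; rewrite Xi|right].
Qed.

(** A common upper component would have a boundary vertex in [X], although all its boundary vertices
    lie in [X'] or [F]. *)
Lemma thicken_disjoint i (X X' F : T -> Prop) z :
  (forall w, X w -> layer w = i) -> (forall w, X' w -> layer w = i) ->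
  (forall w, X w -> ~ X' w /\ ~ F w) -> thicken i X F z -> ~ thicken i X' F z.
Proof.
move=> Xi X'i XX' lX lX'.
have [[lz Xz]|lz] := thicken_layer Xi lX; have [[lz' X'z]|lz'] := thicken_layer X'i lX'; try lia.
  by case: (XX' z Xz).
case: lX => [/Xi|[[w Xw bw] _]]; first by lia.
case: lX' => [/X'i|[_ /(_ w bw)]]; first by lia.
by case: (XX' w Xw) => ? ? [].
Qed.

Lemma thicken_upper i (X F : T -> Prop) x z : (forall w, X w -> layer w = i) ->
  i < layer x -> upper i.+1 x z -> thicken i X F x -> thicken i X F z.
Proof.
move=> Xi ix xz [/Xi|[[w Xw bw] h]]; first by lia.
right; split; first by exists w => //; exact: boundary_upper bw.
move=> u uz; apply: h; apply: boundary_upper uz; exact: conn_sym.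
Qed.

Lemma thicken_conn_boundary i (X F : T -> Prop) x w : (forall w, X w -> layer w = i) ->
  i < layer x -> thicken i X F x -> X w -> boundary_vertex i.+1 x w ->
  conn E (thicken i X F) x w.
Proof.
move=> Xi ix lx Xw [_ [z xz zw]]; apply: (conn_step _ zw); last by left.
by apply: conn_sub xz => u xu; exact: thicken_upper xu lx.
Qed.

Lemma shadow_boundary w w' x u : shadow w w' -> boundary_vertex (layer w).+1 x w ->
  boundary_vertex (layer w).+1 x w' -> boundary_vertex (layer w).+1 x u ->
  u = w \/ u = w'.
Proof.
move=> [_ ww' _] bw bw' bu.
by have [|->|->] := boundary_le2 bw bw' bu; [|left|right].
Qed.

(** If a shadow edge inside [X] comes from an upper component, its two ends are by [boundary_le2]
    the only boundary vertices of that component, which thus belongs to the thickening and joins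
    them. *)
Lemma thicken_connected i (X F : T -> Prop) : (forall w, X w -> layer w = i) ->
  (forall x y, X x -> X y -> conn shadow X x y) -> connected_in E (thicken i X F).
Proof.
move=> Xi Xc.
have cX x y : X x -> X y -> conn E (thicken i X F) x y.
  move=> Xx Xy; elim: (Xc x y Xx Xy) => [_|u v xu xu' uv Xv].
    by apply: conn_refl; left.
  have Xu := conn_memr xu; apply: conn_trans xu' _.
  have [luv nuv [e|[z [bu bv]]]] := uv; first by apply: conn_edge e; left.
  have sb w := shadow_boundary uv bu bv (u := w); rewrite (Xi u Xu) in bu bv sb.
  have lz : thicken i X F z.
    by right; split; [exists u|move=> w /sb[->|->]; left].
  have iz := boundary_layer bu.
  apply: (@conn_trans _ _ _ _ z); last exact: thicken_conn_boundary.
  by apply: conn_sym => //; exact: thicken_conn_boundary.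
have toX x : thicken i X F x -> exists2 w, X w & conn E (thicken i X F) x w.
  move=> lx; have [[_ Xx]|ix] := thicken_layer Xi lx; first by exists x => //; exact: cX.
  case: (lx) => [/Xi|[[w Xw bw] _]]; first by lia.
  by exists w => //; exact: thicken_conn_boundary.
move=> x y /toX[w Xw xw] /toX[w' Xw' yw'].
by apply: conn_trans xw _; apply: conn_trans (cX _ _ Xw Xw') _; exact: conn_sym.
Qed.

(** An upper component behind the shadow edge attaches only to [v] and [p]; it therefore belongs to
    the thickening and supplies an edge to [p]. *)
Lemma thicken_touches i (X F : T -> Prop) v p : (forall w, X w -> layer w = i) ->
  X v -> F p -> shadow v p -> touches E (eq p) (thicken i X F).
Proof.
move=> Xi Xv Fp vp; have [lvp nvp [e|[z [bv bp]]]] := vp.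
  by exists p, v; split; [|left|exact: Esym].
have sb w := shadow_boundary vp bv bp (u := w); rewrite (Xi v Xv) in bv bp sb.
have lz : thicken i X F z.
  by right; split; [exists v|move=> w /sb[->|->]; [left|right]].
have iz := boundary_layer bv; have [_ [y zy yp]] := bp.
by exists p, y; split; [|exact: thicken_upper zy lz|exact: Esym].
Qed.

Lemma lower_touches i r (X : T -> Prop) v : 0 < i -> X v -> layer v = i -> rep E v = r ->
  touches E (lower i r) X.
Proof.
case: i => // i _ Xv /layer_pred[y yv ly] <-.
by exists y, v; split=> //; split; [rewrite ly|rewrite (rep_edge yv)].
Qed.

Lemma single_connected (w : T) : connected_in E (eq w).
Proof. by move=> u v <- <-; exact: conn_refl. Qed.

Lemma thicken_sub_touches i r (X F : T -> Prop) v : 0 < i -> X v -> layer v = i ->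
  rep E v = r -> touches E (lower i r) (thicken i X F).
Proof. by move=> i0 Xv; apply: lower_touches => //; left. Qed.

(** Three neighbours of [w] would be branch sets of a K_{2,3} minor, each thickened by the upper
    components that attach to it and otherwise only to [w]; the hubs are [w] and the lower
    layers. *)
Lemma shadow_deg2 w a b c : shadow w a -> shadow w b -> shadow w c ->
  [\/ a = b, a = c | b = c].
Proof.
move=> wa wb wc; apply: contrapT => abc.
have nab : a <> b by move=> ab; apply: abc; constructor 1.
have nac : a <> c by move=> ac; apply: abc; constructor 2.
have nbc : b <> c by move=> bc'; apply: abc; constructor 3.
have w0 := shadow_layer_gt0 wa; set i := layer w in w0.
have [[la na _] [lb nb _] [lc nc _]] := And3 wa wb wc.
have li v : layer w = layer v -> forall u, v = u -> layer u = i by move=> lv u <-.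
have dis u v z : layer w = layer u -> layer w = layer v -> w <> u -> u <> v ->
    thicken i (eq u) (eq w) z -> ~ thicken i (eq v) (eq w) z.
  move=> lu lv wu uv; apply: thicken_disjoint; [exact: li|exact: li|].
  by move=> y <-; split=> // /esym.
have one u z : layer w = layer u -> w <> u -> thicken i (eq u) (eq w) z ->
    ~ lower i (rep E w) z /\ w <> z.
  move=> lu wu /(thicken_layer (li u lu))[[lz uz]|lz].
    by subst z; split=> // -[]; rewrite -lu ltnn.
  by split; [case; lia|move=> wz; subst z; rewrite ltnn in lz].
have lc1 u : layer w = layer u -> connected_in E (thicken i (eq u) (eq w)).
  move=> lu; apply: thicken_connected; first exact: li.
  by move=> x y <- <-; exact: conn_refl.
have tw u : shadow w u -> touches E (eq w) (thicken i (eq u) (eq w)).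
  move=> wu; apply: (@thicken_touches _ _ _ u) => //; last exact: shadow_sym.
  by apply: li; case: wu.
have tl u : shadow w u -> touches E (lower i (rep E w)) (thicken i (eq u) (eq w)).
  move=> wu; apply: (@thicken_sub_touches _ _ _ _ u) => //; first by case: wu.
  exact/esym/shadow_rep.
apply: (@K23_minor_free_sets _ _ K23 (lower i (rep E w)) (eq w) (thicken i (eq a) (eq w))
  (thicken i (eq b) (eq w)) (thicken i (eq c) (eq w))); try by auto.
- exact: lower_connected.
- exact: single_connected.
- by move=> x [lx _] wx; subst x; rewrite ltnn in lx.
- move=> x ax; have [? ?] := one _ _ la na ax.
  by split=> //; apply: dis ax.
- move=> x bx; have [? ?] := one _ _ lb nb bx.
  by split=> //; apply: dis bx.
- by move=> x; exact: one.
Qed.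

(** Here the hubs are [w] and [w'], and the lower layers serve as the third branch set beside the
    two thickened arcs. *)
Lemma shadow_no_long_cycle (w w' : T) (A A' : T -> Prop) :
  w <> w' -> (forall z, A z -> [/\ z <> w, z <> w' & ~ A' z]) ->
  (forall z, A' z -> z <> w /\ z <> w') ->
  (forall x y, A x -> A y -> conn shadow A x y) ->
  (forall x y, A' x -> A' y -> conn shadow A' x y) ->
  (exists2 a, A a & shadow w a) -> (exists2 a, A a & shadow w' a) ->
  (exists2 a, A' a & shadow w a) -> (exists2 a, A' a & shadow w' a) -> False.
Proof.
move=> ww' dA dA' cA cA' [a Aa wa] [b Ab w'b] [a' Aa' wa'] [b' Ab' w'b'].
have w0 := shadow_layer_gt0 wa; set i := layer w in w0.
have cl (S : T -> Prop) x y : conn shadow S x y -> layer y = layer x /\ rep E y = rep E x.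
  elim=> // u v _ [<- <-] uv _; split; last exact/esym/shadow_rep.
  by case: uv.
have lay (S : T -> Prop) u : (forall x y, S x -> S y -> conn shadow S x y) ->
    S u -> shadow w u -> forall v, S v -> layer v = i.
  by move=> cS Su [lu _ _] v Sv; have [-> _] := cl _ _ _ (cS u v Su Sv).
have Ai := lay _ _ cA Aa wa; have A'i := lay _ _ cA' Aa' wa'.
have lw' : layer w' = i by rewrite -(Ai b Ab); case: w'b.
have rw' : rep E w' = rep E w.
  by rewrite (shadow_rep w'b) (shadow_rep wa); have [_ ->] := cl _ _ _ (cA a b Aa Ab).
pose F z := w = z \/ w' = z.
have Fd (S : T -> Prop) : (forall z, S z -> z <> w /\ z <> w') -> forall z, S z -> ~ F z.
  by move=> dS z /dS[zw zw'] [/esym|/esym].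
have dA0 z : A z -> z <> w /\ z <> w' by move=> /dA[].
have out (S : T -> Prop) z : (forall v, S v -> layer v = i) ->
    (forall z, S z -> z <> w /\ z <> w') -> thicken i S F z ->
    [/\ ~ lower i (rep E w) z, w <> z & w' <> z].
  move=> Si dS /(thicken_layer Si)[[lz Sz]|lz].
    have [zw zw'] := dS z Sz; split; [|by move=> /esym..].
    by case; rewrite lz ltnn.
  split; first by case; lia.
    by move=> wz; subst z; rewrite ltnn in lz.
  by move=> wz; subst z; rewrite lw' ltnn in lz.
apply: (@K23_minor_free_sets _ _ K23 (eq w) (eq w') (thicken i A F) (thicken i A' F)
  (lower i (rep E w))).
- exact: single_connected.
- exact: single_connected.
- exact: thicken_connected.
- exact: thicken_connected.
- exact: lower_connected.
- by move=> x <- /esym.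
- move=> x Ax; have [? ? ?] := out _ _ Ai dA0 Ax; split=> //.
  move: Ax; apply: thicken_disjoint => // z Az.
  by split; [case: (dA z Az)|exact: Fd Az].
- by move=> x A'x; have [] := out _ _ A'i dA' A'x.
- move=> x [lx _]; split=> xx; subst x; first by rewrite ltnn in lx.
  by rewrite lw' ltnn in lx.
- by apply: (@thicken_touches _ _ _ a) => //; [left|exact: shadow_sym].
- by apply: (@thicken_touches _ _ _ a') => //; [left|exact: shadow_sym].
- have [x [y [lx wy xy]]] := @lower_touches i (rep E w) (eq w) w w0 erefl erefl erefl.
  by exists y, x; split=> //; exact: Esym.
- by apply: (@thicken_touches _ _ _ b) => //; [right|exact: shadow_sym].
- by apply: (@thicken_touches _ _ _ b') => //; [right|exact: shadow_sym].
- have [x [y [lx wy xy]]] := @lower_touches i (rep E w) (eq w') w' w0 erefl lw' rw'.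
  by exists y, x; split=> //; exact: Esym.
Qed.

End Layers.

(** * Greedy colouring along a rank *)

Section Greedy.
Variables (T : finType) (H : T -> T -> Prop) (rank : T -> nat) (d : nat).
Hypothesis Hsym : forall x y, H x y -> H y x.
Hypothesis Hrank : forall x y, H x y -> rank x <> rank y.
Hypothesis back : forall x, #|[pred y | `[< H x y /\ rank y < rank x >]]| <= d.

Lemma greedy_coloring : exists c : T -> 'I_d.+1, forall x y, H x y -> c x <> c y.
Proof.
suff [c cP] : exists c : T -> 'I_d.+1, forall x y,
    rank x < (\max_z rank z).+1 -> rank y < (\max_z rank z).+1 -> H x y -> c x <> c y.
  by exists c => x y; apply: cP; rewrite ltnS leq_bigmax.
elim: (\max_z rank z).+1 => [|n [c cP]]; first by exists (fun=> ord0).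
pose used x := [seq c y | y in [pred y | `[< H x y /\ rank y < rank x >]]].
have free x : exists k, k \notin used x.
  apply/existsP; rewrite -negb_forall; apply/negP => /forallP all_used.
  have : #|'I_d.+1| <= size (used x).
    by apply: leq_trans (card_size _); apply/subset_leq_card/fintype.subsetP => k _.
  by rewrite card_ord size_map -cardE leqNgt ltnS back.
(* All vertices of rank [n] are coloured at once; by [Hrank] no two of them are adjacent. *)
pose c' x := if rank x == n then xchoose (free x) else c x.
have new x y : rank x = n -> rank y < n -> H x y -> c' x <> c' y.
  move=> rx ry xy; rewrite /c' rx eqxx (ltn_eqF ry) => cxy.
  have := xchooseP (free x); rewrite cxy => /negP; apply.
  by apply: map_f; rewrite mem_enum inE rx.
exists c' => x y; rewrite !ltnS (leq_eqVlt (rank x)) (leq_eqVlt (rank y)).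
move=> /orP[/eqP rx|rx] /orP[/eqP ry|ry] xy.
- by case: (Hrank xy); rewrite rx.
- exact: new.
- by move=> /esym; apply: new => //; exact: Hsym.
- by rewrite /c' (ltn_eqF rx) (ltn_eqF ry); exact: cP.
Qed.

End Greedy.

Lemma card_le2 (T : finType) (P : T -> Prop) :
  (forall a b c, P a -> P b -> P c -> [\/ a = b, a = c | b = c]) ->
  #|[pred x | `[< P x >]]| <= 2.
Proof.
move=> h; rewrite leqNgt; apply/negP => /card_gt2P[a [b [c [[]]]]].
rewrite !inE => Pa Pb Pc [ab bc ca].
by have [E|E|E] := h a b c Pa Pb Pc; subst; rewrite eqxx in ab bc ca.
Qed.

Lemma card_window (T : finType) (P : T -> Prop) (p : T -> nat) (c : nat) :
  (forall x y, P x -> P y -> p x = p y -> x = y) ->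
  (forall x y, P x -> P y -> p x <= p y + c) ->
  #|[pred x | `[< P x >]]| <= c.+1.
Proof.
move=> pinj pwin; have [-> //|/card_gt0P[x0 Px0]] := posnP #|[pred x | `[< P x >]]|.
case: (arg_minnP p Px0) => m /= /asboolP Pm mmin.
rewrite cardE -(size_map p) -(size_iota (p m) c.+1); apply: uniq_leq_size.
  rewrite map_inj_in_uniq ?enum_uniq // => x y.
  by rewrite !mem_enum !inE => Px Py; exact: pinj.
move=> k /mapP[x]; rewrite mem_enum => Px ->.
have mx := mmin x Px; rewrite inE in Px.
by rewrite mem_iota mx /= addnS ltnS pwin.
Qed.

(** * Conflicts between parents and the ten colours *)

Section Coloring.
Variables (T : finType) (E : T -> T -> Prop).
Hypothesis Esym : forall x y, E x y -> E y x.
Hypothesis K23 : K23_minor_free E.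

Let lay := layer E.
Let sh := shadow E.
Let ps := pos sh.

Let sh_sym x y : sh x y -> sh y x. Proof. exact: shadow_sym. Qed.
Let sh_irr x : ~ sh x x. Proof. by case. Qed.

Let ps_inj x y : reach sh x y -> ps x = ps y -> x = y.
Proof. by apply: pos_inj => //; exact: shadow_deg2. Qed.

Let ps_edge x y : sh x y -> ps y <= (ps x).+1 \/ (forall z, reach sh x z -> ps z <= 2).
Proof.
by apply: pos_edge => //; [exact: shadow_deg2|exact: shadow_no_long_cycle].
Qed.

Let alike x y := x = y \/ sh x y.

Lemma alike_reach x y : alike x y -> reach sh x y.
Proof. by case=> [->|xy]; [exact: reach_refl|exact: reach_edge (reach_refl _ _) xy]. Qed.

Lemma alike_sym x y : alike x y -> alike y x.
Proof. by case=> [->|xy]; [left|right; exact: shadow_sym]. Qed.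

Lemma alike_pos x y : alike x y -> ps y <= (ps x).+1 \/ (forall z, reach sh x z -> ps z <= 2).
Proof. by case=> [->|/ps_edge//]; left. Qed.

Lemma alike_upper i z z' w w' : lay w = i -> lay w' = i -> upper E i.+1 z z' ->
  E z w -> E z' w' -> alike w w'.
Proof.
move=> lw lw' zz' zw zw'; have [ww'|ww'] := pselect (w = w'); first by left.
right; split=> //; first by rewrite -/lay lw.
right; exists z; rewrite -/lay lw; split; split; rewrite -?/lay ?lw ?lw' //.
  by exists z => //; apply: conn_refl; exact: conn_meml zz'.
by exists z'.
Qed.

(* The parent of least position, so that all siblings pick consistently. *)
Definition parent (x : T) : T :=
  odflt x [pick y | `[< [/\ E y x, (lay y).+1 = lay x &
    forall z, E z x -> (lay z).+1 = lay x -> ps y <= ps z] >]].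

Lemma parentP x n : lay x = n.+1 -> [/\ E (parent x) x, lay (parent x) = n &
  forall z, E z x -> lay z = n -> ps (parent x) <= ps z].
Proof.
move=> lx; rewrite /parent lx; case: pickP => [y /asboolP[yx [ly] ymin]|none].
  by split=> // z zx lz; apply: ymin => //; rewrite lz.
have [y0 y0x ly0] := layer_pred Esym lx.
have Py0 : `[< E y0 x /\ lay y0 = n >] by apply/asboolP.
case: (arg_minnP (P := fun y => `[< E y x /\ lay y = n >]) ps Py0) => m /asboolP[mx lm] mmin.
have /asboolP[] := none m; split; rewrite ?lm // => z zx [lz].
by apply: mmin; apply/asboolP.
Qed.

Lemma parent0 x : lay x = 0 -> parent x = x.
Proof. by rewrite /parent => ->; case: pickP => // y /asboolP[]. Qed.

Lemma parent_closed x : parent x = x \/ E x (parent x).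
Proof.
case lx: (lay x) => [|n]; first by left; exact: parent0.
by right; have [/Esym] := parentP lx.
Qed.

Lemma parent_rep x : rep E (parent x) = rep E x.
Proof. by have [->//|/(rep_edge Esym)] := parent_closed x. Qed.

Definition exactly3 (x y : T) : Prop :=
  (exists s t, [/\ E x s, E s t & E t y]) /\
  [/\ x <> y, ~ E x y & ~ exists2 z, E x z & E z y].

Lemma exactly3_sym x y : exactly3 x y -> exactly3 y x.
Proof.
case=> -[s [t [xs st ty]]] [xy Exy nz]; split.
  by exists t, s; split; exact: Esym.
split; [by move=> /esym|by move=> /Esym|].
by move=> [z /Esym zy /Esym xz]; apply: nz; exists z.
Qed.

(** A parent lies in the closed neighbourhood of its vertex, and closed neighbourhoods of vertices
    at distance three are disjoint. *)
Lemma parent_neq x y : exactly3 x y -> parent x <> parent y.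
Proof.
move=> [_ [xy Exy nz]] pxy.
have [px|px] := parent_closed x; have [py|py] := parent_closed y.
- by apply: xy; rewrite -px pxy.
- by apply: Exy; apply: Esym; rewrite -px pxy.
- by apply: Exy; rewrite -py -pxy.
- by apply: nz; exists (parent x) => //; rewrite pxy; exact: Esym.
Qed.

Definition conflict (u v : T) : Prop :=
  exists x y, [/\ exactly3 x y, parent x = u & parent y = v].

Lemma conflict_sym u v : conflict u v -> conflict v u.
Proof. by move=> [x [y [/exactly3_sym xy <- <-]]]; exists y, x. Qed.

Lemma conflict_neq u v : conflict u v -> u <> v.
Proof. by move=> [x [y [/parent_neq xy <- <-]]]. Qed.

(** Lexicographic order by layer and position. Vertices of different shadow components may tie;
    [conflict_rank] shows that conflicting ones do not. *)
Definition rank (x : T) : nat := lay x * (\max_z ps z).+1 + ps x.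

Lemma rank_le x y : rank x <= rank y -> lay x <= lay y.
Proof.
rewrite /rank => rxy; rewrite leqNgt; apply/negP => lyx.
have := leq_bigmax (F := ps) y; have := leq_mul lyx (leqnn (\max_z ps z).+1).
lia.
Qed.

Lemma rank_lt_pos x y : lay x = lay y -> (rank x < rank y) = (ps x < ps y).
Proof. by rewrite /rank => ->; rewrite ltn_add2l. Qed.

(** Boundary vertices at level [k] lie in layer [k - 1], so these are three layers below [u]. When
    the subtraction gives level 0 there are none. *)
Definition back3 (u v : T) : Prop := boundary_vertex E (lay u - 2) u v.
Definition back2 (u v : T) : Prop := boundary_vertex E (lay u - 1) u v.
(** [v] need not be a boundary vertex itself. The bound [ps v <= ps w] comes from the minimality of
    the parent and excludes a fourth candidate. *)
Definition back1 (u v : T) : Prop := exists2 w, boundary_vertex E (lay u) u w &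
  alike w v /\ ps v <= ps w.
Definition back0 (u v : T) : Prop := [/\ reach sh u v, ps v < ps u & ps u <= ps v + 2].

Lemma layer_near x y : E x y -> lay x <= (lay y).+1 /\ lay y <= (lay x).+1.
Proof. by move=> xy; split; apply: layer_edge => //; exact: Esym. Qed.

Lemma upper_edge k x y : E x y -> k <= lay x -> k <= lay y -> upper E k x y.
Proof. by move=> xy kx ky; exact: conn_edge. Qed.

Lemma back_lower x y s t i j : E x s -> E s t -> E t y ->
  lay x = i.+1 -> lay y = j.+1 -> j < i ->
  [\/ back3 (parent x) (parent y), back2 (parent x) (parent y) |
      back1 (parent x) (parent y)].
Proof.
move=> xs st ty lx ly ji.
have [ux lu _] := parentP lx; have [vy lv vmin] := parentP ly.
set u := parent x in ux lu *; set v := parent y in vy lv vmin *.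
have [? ?] := layer_near xs; have [? ?] := layer_near st; have [? ?] := layer_near ty.
(* If [t] is in a layer beyond [j], the path from [x] to [y] stays in such layers and [v] is a
   boundary vertex of [u]. Otherwise [t] is in layer [j], one layer below [u], and is a rival
   candidate for the parent of [y]. *)
have [tj|jt] := leqP (lay t) j; last first.
  have b : boundary_vertex E j.+1 u v.
    split; first by rewrite -/lay lv.
    exists y; last exact: Esym.
    apply: (@conn_trans _ _ _ _ x); first by apply: upper_edge => //; lia.
    apply: (@conn_trans _ _ _ _ s); first by apply: upper_edge => //; lia.
    by apply: (@conn_trans _ _ _ _ t); apply: upper_edge => //; lia.
  have [ij|] := eqVneq i j.+1.
    constructor 3; exists v; first by rewrite lu ij.
    by split=> //; left.
  have [ij _|ij ij'] := eqVneq i j.+2.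
    by constructor 2; rewrite /back2 lu ij subn1.
  constructor 1; rewrite /back3 lu; have -> : i - 2 = j.+1 by lia.
  by [].
have lt : lay t = j by lia.
have ij : i = j.+1 by lia.
have ls : lay s = j.+1 by lia.
constructor 3; exists t.
  split; first by rewrite -/lay lt lu ij.
  exists s => //; rewrite lu.
  apply: (@conn_trans _ _ _ _ x); apply: upper_edge => //; lia.
split; last by apply: vmin => //.
apply: (alike_upper (i := j) (z := y) (z' := y)) => //; try exact: Esym.
by apply: conn_refl; rewrite -/lay ly.
Qed.

Lemma back_level x y s t i : E x s -> E s t -> E t y ->
  lay x = i.+1 -> lay y = i.+1 ->
  reach sh (parent x) (parent y) /\ ps (parent x) <= ps (parent y) + 2.
Proof.
move=> xs st ty lx ly.
have [ux lu umin] := parentP lx; have [vy lv _] := parentP ly.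
set u := parent x in ux lu umin *; set v := parent y in vy lv *.
have [? ?] := layer_near xs; have [? ?] := layer_near st; have [? ?] := layer_near ty.
(* The path is pushed into layer [i]: [s'] is [s] if [s] lies there and [u] otherwise, [t'] is [t]
   or [v]. Of the three steps from [u] to [v] the first is free, since [u] has least position among
   the candidates for the parent of [x]. *)
suff [s' [t' [us s't' t'v pus]]] : exists s' t',
    [/\ alike u s', alike s' t', alike t' v & ps u <= ps s'].
  have us' := alike_reach us; have ut' := reach_trans us' (alike_reach s't').
  have uv := reach_trans ut' (alike_reach t'v).
  split=> //; have [ts|small] := alike_pos (alike_sym s't').
    have [vt|small] := alike_pos (alike_sym t'v); first by lia.
    have : ps u <= 2 by apply: small; exact: reach_sym.
    lia.
  have : ps u <= 2 by apply: small; exact: reach_sym.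
  lia.
have xx : upper E i.+1 x x by apply: conn_refl; rewrite -/lay lx.
have yy : upper E i.+1 y y by apply: conn_refl; rewrite -/lay ly.
have nn w : alike w w by left.
have [si|si] := leqP (lay s) i; have [ti|ti] := leqP (lay t) i.
- have ls : lay s = i by lia.
  have lt : lay t = i by lia.
  exists s, t; split.
  + by apply: alike_upper xx _ _ => //; exact: Esym.
  + have [->|nst] := pselect (s = t); first by left.
    by right; split; [rewrite -/lay ls|..|left].
  + by apply: alike_upper yy _ _ => //; exact: Esym.
  + by apply: umin => //; exact: Esym.
- have ls : lay s = i by lia.
  exists s, v; split=> //.
  + by apply: alike_upper xx _ _ => //; exact: Esym.
  + apply: (alike_upper (i := i) (z := t) (z' := y)) => //; try exact: Esym.
    by apply: upper_edge => //; rewrite ly.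
  + by apply: umin => //; exact: Esym.
- have lt : lay t = i by lia.
  exists u, t; split=> //.
  + apply: (alike_upper (i := i) (z := x) (z' := s)) => //; try exact: Esym.
    by apply: upper_edge => //; rewrite lx.
  + by apply: alike_upper yy _ _ => //; exact: Esym.
- exists u, v; split=> //.
  apply: (alike_upper (i := i) (z := x) (z' := y)) => //; try exact: Esym.
  apply: (@conn_trans _ _ _ _ s); first by apply: upper_edge => //; lia.
  by apply: (@conn_trans _ _ _ _ t); apply: upper_edge => //; lia.
Qed.

Lemma conflict_rep u v : conflict u v -> rep E v = rep E u.
Proof.
move=> [x [y [[[s [t [xs st ty]]] _] <- <-]]]; rewrite !parent_rep.
by rewrite -(rep_edge Esym ty) -(rep_edge Esym st) (rep_edge Esym xs).
Qed.

Lemma layer0_eq u v : lay u = 0 -> lay v = 0 -> rep E v = rep E u -> u = v.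
Proof. by move=> lu lv uv; rewrite (layer_eq0 Esym lu) -uv -(layer_eq0 Esym lv). Qed.

Lemma conflict_level u v : conflict u v -> lay u = lay v ->
  reach sh u v /\ ps u <= ps v + 2.
Proof.
move=> uv luv; have [lu0|lu0] := eqVneq (lay u) 0.
  by case: (conflict_neq uv); apply: layer0_eq (conflict_rep uv); rewrite // -luv.
have [x [y [[[s [t [xs st ty]]] _] pu pv]]] := uv.
case lx: (lay x) => [|i]; first by rewrite -pu (parent0 lx) lx in lu0.
case ly: (lay y) => [|j]; first by rewrite luv -pv (parent0 ly) ly in lu0.
have [_ lu _] := parentP lx; have [_ lv _] := parentP ly.
rewrite -pu -pv; apply: back_level xs st ty lx _.
by rewrite ly -lu -lv pu pv luv.
Qed.

Lemma conflict_rank u v : conflict u v -> rank u <> rank v.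
Proof.
move=> uv ruv; have luv : lay u = lay v.
  by apply/eqP; rewrite eqn_leq !rank_le // ruv.
have [ruv' _] := conflict_level uv luv; apply: (conflict_neq uv).
apply: ps_inj ruv' _; move: ruv; rewrite /rank luv; lia.
Qed.

Lemma conflict_back u v : conflict u v -> rank v < rank u ->
  [\/ back3 u v, back2 u v, back1 u v | back0 u v].
Proof.
move=> uv rvu; have lvu := rank_le (ltnW rvu).
have [luv|nluv] := eqVneq (lay u) (lay v).
  by constructor 4; have [? ?] := conflict_level uv luv; split; rewrite // -rank_lt_pos.
have {lvu nluv} lvu : lay v < lay u by rewrite ltn_neqAle eq_sym nluv.
have ruv := conflict_rep uv.
have [x [y [[[s [t [xs st ty]]] _] pu pv]]] := uv.
have [? ?] := layer_near xs; have [? ?] := layer_near st; have [? ?] := layer_near ty.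
case lx: (lay x) => [|i]; first by rewrite -pu (parent0 lx) lx in lvu.
have [_ lu _] := parentP lx; rewrite pu in lu.
case ly: (lay y) => [|j].
  have yv := parent0 ly; have lv : lay v = 0 by rewrite -pv yv.
  (* A root is its own parent, so [back_lower] does not apply; [v] is the only vertex of layer 0 in
     its component, hence the boundary vertex at level 1. *)
  have [w bw] : exists w, boundary_vertex E 1 u w.
    by apply: boundary_ex => //; rewrite -/lay; lia.
  have wv : w = v.
    by apply: layer0_eq => //; [case: bw => [[]]|rewrite (boundary_rep Esym bw)].
  subst w; have [i1|i2] := eqVneq i 1.
    by constructor 3; exists v; rewrite ?lu ?i1 //; split=> //; left.
  by constructor 2; rewrite /back2; have -> : lay u - 1 = 1 by lia.
have [_ lv _] := parentP ly; rewrite pv in lv.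
have ji : j < i by lia.
by have := back_lower xs st ty lx ly ji; rewrite pu pv => -[?|?|?];
  [constructor 1|constructor 2|constructor 3].
Qed.

Lemma card_back1 u : #|[pred v | `[< back1 u v >]]| <= 3.
Proof.
have alikeb w w' : boundary_vertex E (lay u) u w -> boundary_vertex E (lay u) u w' -> alike w w'.
  move=> bw bw'; have [|ww'] := pselect (w = w'); first by left.
  have [lw _] := bw; have [lw' _] := bw'.
  right; split=> //; first by rewrite -/lay; apply: succn_inj; rewrite lw lw'.
  by right; exists u; rewrite lw.
have rb v v' : back1 u v -> back1 u v' -> reach sh v v'.
  move=> [w bw [wv _]] [w' bw' [wv' _]].
  apply: reach_trans (alike_reach (alike_sym wv)) _.
  exact: reach_trans (alike_reach (alikeb _ _ bw bw')) (alike_reach wv').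
apply: (card_window (p := ps)) => v v' bv bv'; first exact/ps_inj/rb.
have vv' := rb _ _ bv bv'.
have small w : alike w v \/ alike w v' -> (forall z, reach sh w z -> ps z <= 2) -> ps v <= ps v' + 2.
  move=> wvv' h; apply: leq_trans (leq_addl _ _); apply: h.
  case: wvv' => /alike_reach // wv'; apply: reach_trans wv' _; exact: reach_sym.
case: bv bv' => [w bw [wv vw]] [w' bw' [wv' vw']].
(* Along [v'], [w'], [w], [v] consecutive vertices are alike; the last step does not raise the
   position, so at most 2 is gained. *)
have [w'w|h] := alike_pos (alikeb _ _ bw' bw); last by apply: small h; right.
have [v'w'|h] := alike_pos (alike_sym wv'); last by apply: (small v') h; right; left.
lia.
Qed.

Lemma card_back0 u : #|[pred v | `[< back0 u v >]]| <= 2.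
Proof.
apply: (card_window (p := ps)) => v v' [uv vu uv2] [uv' vu' uv2']; last by lia.
by apply: ps_inj; apply: reach_trans uv'; exact: reach_sym.
Qed.

Lemma card_boundary k u : #|[pred v | `[< boundary_vertex E k u v >]]| <= 2.
Proof. apply: card_le2 => a b c; exact: boundary_le2. Qed.

Lemma card_conflict_back u : #|[pred v | `[< conflict u v /\ rank v < rank u >]]| <= 9.
Proof.
have sub : {subset [pred v | `[< conflict u v /\ rank v < rank u >]] <=
    [predU [predU [pred v | `[< back3 u v >]] & [pred v | `[< back2 u v >]]] &
     [predU [pred v | `[< back1 u v >]] & [pred v | `[< back0 u v >]]]]}.
  move=> v; rewrite !inE => -[uv vu].
  by have [h|h|h|h] := conflict_back uv vu; rewrite (asboolT h) ?orbT.
move/fintype.subsetP/subset_leq_card: sub => /leq_trans; apply.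
have cU (A B : {pred T}) m n : #|A| <= m -> #|B| <= n -> #|[predU A & B]| <= m + n.
  by move=> Am Bn; rewrite -(leq_add2r #|[predI A & B]|) cardUI; lia.
apply: (cU _ _ 4 5); first by apply: (cU _ _ 2 2); exact: card_boundary.
by apply: (cU _ _ 3 2); [exact: card_back1|exact: card_back0].
Qed.

Theorem exactly3_coloring :
  exists c : T -> 'I_10, forall x y, exactly3 x y -> c x <> c y.
Proof.
have [c cP] := greedy_coloring conflict_sym conflict_rank card_conflict_back.
by exists (c \o parent) => x y xy; apply: cP; exists x, y.
Qed.

End Coloring.

(** * Exact distance graphs and chromatic numbers *)

Definition adjacent (G : sgraph) (x y : G) : Prop := edge x y.

Lemma walk0 (G : sgraph) (x y : G) : walk 0 x y = (x == y).
Proof.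
apply/existsP/eqP => [[s]|->]; first by rewrite tuple0 /= => /eqP.
by exists [tuple]; rewrite /= eqxx.
Qed.

Lemma walkS (G : sgraph) n (x y : G) :
  walk n.+1 x y = [exists z, edge x z && walk n z y].
Proof.
apply/existsP/existsP => [[s]|[z /andP[xz /existsP[s sz]]]].
  case/tupleP: s => z s /= /andP[/andP[xz zs] sy].
  by exists z; rewrite xz /=; apply/existsP; exists s; rewrite zs.
by exists [tuple of z :: s]; rewrite /= xz.
Qed.

Lemma walk1 (G : sgraph) (x y : G) : walk 1 x y = edge x y.
Proof.
rewrite walkS; apply/existsP/idP => [[z]|xy].
  by rewrite walk0 => /andP[xz /eqP<-].
by exists y; rewrite walk0 eqxx andbT.
Qed.

Lemma at_distance3P (G : sgraph) (x y : G) :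
  at_distance 3 x y <-> exactly3 (@adjacent G) x y.
Proof.
rewrite /at_distance /exactly3 walkS; split.
  move=> /andP[/existsP[s /andP[xs]]]; rewrite walkS => /existsP[t /andP[st]].
  rewrite walk1 => ty /forallP short; split; first by exists s, t.
  split.
  - by have := short ord0; rewrite walk0 => /eqP.
  - by have := short (@Ordinal 3 1 isT); rewrite walk1 => /negP.
  move=> [z xz zy]; have /negP := short (@Ordinal 3 2 isT); apply.
  by rewrite walkS; apply/existsP; exists z; rewrite walk1; apply/andP.
move=> [[s [t [xs st ty]]] [xy nxy nz]]; apply/andP; split.
  apply/existsP; exists s; rewrite (xs : edge x s) walkS; apply/existsP; exists t.
  by rewrite walk1; apply/andP.
apply/forallP => -[[|[|[|//]]] ? /=].
- by rewrite walk0; apply/eqP.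
- by rewrite walk1; apply/negP.
rewrite walkS; apply/negP => /existsP[z /andP[xz]]; rewrite walk1 => zy.
by apply: nz; exists z.
Qed.

Lemma colorableP (G : sgraph) k :
  colorable G k <-> exists c : G -> 'I_k, forall x y : G, edge x y -> c x <> c y.
Proof.
split=> [/existsP[c /forallP cP]|[c cP]].
  exists c => x y xy; move/forallP/(_ y)/implyP/(_ xy)/eqP: (cP x); exact.
apply/existsP; exists [ffun x => c x]; apply/forallP => x; apply/forallP => y.
by apply/implyP => xy; rewrite !ffunE; apply/eqP/cP.
Qed.

Lemma colorable_widen (G : sgraph) m k : m <= k -> colorable G m -> colorable G k.
Proof.
move=> mk /colorableP[c cP]; apply/colorableP; exists (widen_ord mk \o c) => x y xy.
by move=> /(congr1 val)/= /val_inj; exact: cP.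
Qed.

Lemma chromatic_number_le (G : sgraph) k : colorable G k -> chromatic_number G <= k.
Proof. by rewrite /chromatic_number; case: ex_minnP => m _ /(_ k). Qed.

Lemma chromatic_number_eq (G : sgraph) k :
  colorable G k.+1 -> ~ colorable G k -> chromatic_number G = k.+1.
Proof.
move=> ck nck; apply/eqP; rewrite eqn_leq chromatic_number_le //=.
rewrite /chromatic_number; case: ex_minnP => m cm _; rewrite ltnNge.
by apply/negP => mk; apply: nck; exact: colorable_widen cm.
Qed.

(** * The lower-bound graph and its chromatic number *)

(* Neighbours of each vertex; the vertices are numbered along the outer cycle. *)
Definition G4_nbrs : seq (seq nat) :=
  [:: [:: 1; 4; 9; 18; 20; 21; 22]; [:: 0; 2; 3; 4]; [:: 1; 3]; [:: 1; 2; 4];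
      [:: 0; 1; 3; 5; 6; 9]; [:: 4; 6]; [:: 4; 5; 7; 8; 9]; [:: 6; 8];
      [:: 6; 7; 9]; [:: 0; 4; 6; 8; 10; 11; 14; 18]; [:: 9; 11];
      [:: 9; 10; 12; 13; 14]; [:: 11; 13]; [:: 11; 12; 14];
      [:: 9; 11; 13; 15; 17; 18]; [:: 14; 16; 17]; [:: 15; 17];
      [:: 14; 15; 16; 18]; [:: 0; 9; 14; 17; 19; 20]; [:: 18; 20];
      [:: 0; 18; 19; 21]; [:: 0; 20; 22]; [:: 0; 21]].

Definition G4_adj (i j : nat) : bool := j \in nth [::] G4_nbrs i.

Lemma G4_sym : symmetric (fun i j : 'I_23 => G4_adj i j).
Proof.
have h : all (fun i => all (fun j => G4_adj i j == G4_adj j i) (iota 0 23)) (iota 0 23).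
  by vm_compute.
move=> i j; apply/eqP; have := allP h i; rewrite mem_iota ltn_ord => /(_ isT).
by move=> /allP/(_ (val j)); apply; rewrite mem_iota ltn_ord.
Qed.

Lemma G4_irrefl : irreflexive (fun i j : 'I_23 => G4_adj i j).
Proof.
have h : all (fun i => ~~ G4_adj i i) (iota 0 23) by vm_compute.
by move=> i; apply/negbTE; have := allP h i; apply; rewrite mem_iota ltn_ord.
Qed.

(** The initial triangle is 0, 9, 18. The rounds add 4, 14, 20, then 1, 6, 11, 17, 19, 21, then 3,
    5, 8, 10, 13, 15, 22, and finally 2, 7, 12, 16. *)
Definition G4 : sgraph := SGraph G4_sym G4_irrefl.

Definition G4_far (i j : nat) : bool :=
  [&& has (fun s => has (fun t => G4_adj t j) (nth [::] G4_nbrs s)) (nth [::] G4_nbrs i),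
      i != j, ~~ G4_adj i j & ~~ has (fun s => G4_adj s j) (nth [::] G4_nbrs i)].

Lemma G4_adj_lt i j : G4_adj i j -> j < 23.
Proof.
have h : all (all (fun j => j < 23)) G4_nbrs by vm_compute.
rewrite /G4_adj; have [i23|i23] := ltnP i (size G4_nbrs); last by rewrite nth_default.
by have /allP := all_nthP [::] h i i23; apply.
Qed.

Lemma G4_farP (i j : G4) : at_distance 3 i j = G4_far i j.
Proof.
apply/idP/idP => [/at_distance3P[[s [t [is_ st tj]]] [ij nij nk]]|].
  apply/and4P; split.
  - by apply/hasP; exists (val s) => //; apply/hasP; exists (val t).
  - by apply/eqP => /val_inj.
  - exact/negP.
  - apply/hasPn => k ik; apply/negP => kj; apply: nk.
    by exists (Ordinal (G4_adj_lt ik)).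
move=> /and4P[/hasP[s is_ /hasP[t st tj]] /eqP ij /negP nij /hasPn nk].
apply/at_distance3P; split.
  by exists (Ordinal (G4_adj_lt is_)), (Ordinal (G4_adj_lt st)).
split=> //; first by move=> ijE; apply: ij; rewrite ijE.
by move=> [k ik kj]; move/negP: (nk (val k) ik).
Qed.

(** Evaluated here, so that the search reads a literal table instead of recomputing distances. *)
Definition G4_conflicts : seq (seq nat) :=
  Eval vm_compute in [seq [seq j <- iota 0 23 | G4_far i j] | i <- iota 0 23].

Lemma G4_conflictsP i j : i < 23 -> j < 23 ->
  (j \in nth [::] G4_conflicts i) = G4_far i j.
Proof.
move=> i23 j23.
have -> : G4_conflicts = [seq [seq j <- iota 0 23 | G4_far i j] | i <- iota 0 23].
  by vm_compute.
by rewrite (nth_map 0) ?size_iota // nth_iota // mem_filter mem_iota leq0n !add0n j23 !andbT.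
Qed.

Section Search.
Variables (conflicts : seq (seq nat)) (k : nat).

(* [if] instead of [&&], which call-by-value evaluation would not short-circuit. *)
Fixpoint extendable (vs : seq nat) (col : seq (nat * nat)) : bool :=
  if vs is v :: vs' then
    has (fun a => if all (fun p => (p.2 != a) || (p.1 \notin nth [::] conflicts v)) col
                  then extendable vs' ((v, a) :: col) else false) (iota 0 k)
  else true.

(** The branch that follows [c] never gets stuck, so a failed search refutes all colourings. This
    holds for every list [vs]: its order affects only the running time. *)
Lemma extendable_complete (c : nat -> nat) (vs : seq nat) (col : seq (nat * nat)) :
  (forall v, c v < k) ->
  (forall v w, w \in nth [::] conflicts v -> c v <> c w) ->
  (forall p, p \in col -> p.2 = c p.1) -> extendable vs col.
Proof.
move=> ck cP; elim: vs col => //= v vs IH col colP; apply/hasP; exists (c v).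
  by rewrite mem_iota ck.
rewrite ifT.
  by apply: IH => p; rewrite inE => /orP[/eqP->|/colP].
apply/allP => p pcol; rewrite (colP p pcol) -implyNb negbK; apply/implyP => /eqP cpv.
by apply/negP => /cP; apply; rewrite cpv.
Qed.

End Search.

Lemma G4_not_4colorable : ~ colorable (exact_distance_graph G4 3 isT) 4.
Proof.
move=> /colorableP[c cP].
have : extendable G4_conflicts 4 [:: 8; 22; 19; 10; 15; 20; 6; 3; 11; 21; 17; 5; 2;
    1; 14; 7; 13; 16; 12; 0; 18; 4; 9] [::] = false by vm_compute.
(* [inord] makes the colouring total on numbers; by [lt23] its default value never enters a
   conflict. *)
pose c' v := val (c (inord v)).
suff -> : extendable G4_conflicts 4 [:: 8; 22; 19; 10; 15; 20; 6; 3; 11; 21; 17; 5; 2;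
    1; 14; 7; 13; 16; 12; 0; 18; 4; 9] [::] = true by [].
have lt23 v w : w \in nth [::] G4_conflicts v -> v < 23 /\ w < 23.
  have h : all (all (fun j => j < 23)) G4_conflicts by vm_compute.
  have [v23|v23] := ltnP v (size G4_conflicts); last by rewrite nth_default.
  by move=> wv; split=> //; have /allP := all_nthP [::] h v v23; apply.
apply: (extendable_complete (c := c')) => // [v|v w wv]; first exact: ltn_ord.
have [v23 w23] := lt23 v w wv; move=> /val_inj; apply: cP; rewrite /= G4_farP.
by rewrite !inordK // -G4_conflictsP.
Qed.

Lemma G4_5colorable : colorable (exact_distance_graph G4 3 isT) 5.
Proof.
pose col := [:: 1; 2; 3; 1; 0; 1; 0; 4; 0; 1; 0; 3; 2; 3; 0; 3; 0; 1; 0; 1; 2; 2; 2].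
have h : all (fun i => all (fun j => nth 0 col i != nth 0 col j)
  (nth [::] G4_conflicts i)) (iota 0 23) by vm_compute.
have col5 i : nth 0 col i < 5.
  have [i23|i23] := ltnP i (size col); last by rewrite nth_default.
  have col_lt : all (fun a => a < 5) col by [].
  exact: (all_nthP 0 col_lt).
apply/colorableP; exists (fun i => Ordinal (col5 (val i))) => i j /=.
rewrite G4_farP -G4_conflictsP // => ij [cij].
have := allP h i; rewrite mem_iota ltn_ord => /(_ isT)/allP/(_ _ ij).
by rewrite cij eqxx.
Qed.

Lemma G4_chromatic : chromatic_number (exact_distance_graph G4 3 isT) = 5.
Proof. exact: chromatic_number_eq G4_5colorable G4_not_4colorable. Qed.

(** * The van Kampen obstruction for K_{3,3} *)

Import Order.TTheory GRing.Theory Num.Theory.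
Import numFieldNormedType.Exports.

Section Geometry.
Local Open Scope classical_set_scope.
Local Open Scope ring_scope.

Section VanKampen.
Variable R : realType.
Implicit Types u v w : R * R.

(** Half-open, so that it contains exactly one of [u] and [- u] when [u] is nonzero. *)
Definition upper_half u : bool := (0 < u.2) || ((u.2 == 0) && (0 < u.1)).

(* Parity of the crossings of the segment [u, v] with the positive x-axis,
   meaningful when the segment is short and far from the origin. *)
Definition crosses u v : bool := xorb (upper_half u) (upper_half v) && (0 < u.1).

Lemma upper_halfN u : u != 0 -> upper_half (- u) = ~~ upper_half u.
Proof.
move=> u0; rewrite /upper_half /= oppr_gt0 oppr_eq0 oppr_gt0.
case: (ltrgtP u.2 0) => //= u2.
rewrite -leNgt le_eqVlt; case: eqVneq => //= u1.
by case/eqP: u0; case: u u1 u2 => a b /= -> ->.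
Qed.

Lemma norm_pairE u : `|u| = Num.max `|u.1| `|u.2|.
Proof. by []. Qed.

Lemma same_sign (a b : R) : `|a - b| < `|a| -> (0 < a /\ 0 < b) \/ (a < 0 /\ b < 0).
Proof.
rewrite ltr_norml => /andP[]; case: (lerP 0 a) => a0.
  by rewrite ger0_norm // => ? ?; left; split; lra.
by rewrite ltr0_norm // => ? ?; right; split; lra.
Qed.

(** In the sup norm, points closer to [u] than the origin keep the sign of the coordinate of [u]
    that is largest in absolute value. *)
Lemma close_sides u : u != 0 -> exists S : R * R -> Prop,
  (forall v, `|u - v| < `|u| -> S v) /\
  [\/ forall v, S v -> 0 < v.1, forall v, S v -> v.1 < 0,
      forall v, S v -> 0 < v.2 | forall v, S v -> v.2 < 0].
Proof.
move=> u0; have := norm_pairE u; case: (leP `|u.1| `|u.2|) => _ uE.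
- have u2 : u.2 != 0 by rewrite -normr_eq0 -uE normr_eq0.
  have h v : `|u - v| < `|u| -> `|u.2 - v.2| < `|u.2|.
    by rewrite norm_pairE gt_max => /andP[_]; rewrite uE.
  have [p|n|z] := ltrgtP 0 u.2; last by rewrite -z eqxx in u2.
    exists (fun v => 0 < v.2); split; last by constructor 3.
    by move=> v /h/same_sign[[]//|[]]; lra.
  exists (fun v => v.2 < 0); split; last by constructor 4.
  by move=> v /h/same_sign[[]|[]//]; lra.
- have u1 : u.1 != 0 by rewrite -normr_eq0 -uE normr_eq0.
  have h v : `|u - v| < `|u| -> `|u.1 - v.1| < `|u.1|.
    by rewrite norm_pairE gt_max => /andP[+ _]; rewrite uE.
  have [p|n|z] := ltrgtP 0 u.1; last by rewrite -z eqxx in u1.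
    exists (fun v => 0 < v.1); split; last by constructor 1.
    by move=> v /h/same_sign[[]//|[]]; lra.
  exists (fun v => v.1 < 0); split; last by constructor 2.
  by move=> v /h/same_sign[[]|[]//]; lra.
Qed.

Lemma upper_half_pos u : 0 < u.2 -> upper_half u = true.
Proof. by rewrite /upper_half => ->. Qed.

Lemma upper_half_neg u : u.2 < 0 -> upper_half u = false.
Proof. by rewrite /upper_half => u2; rewrite (lt_eqF u2) ltNge ltW. Qed.

Lemma crosses_left u v : u.1 < 0 -> crosses u v = false.
Proof. by rewrite /crosses => u1; rewrite [0 < _]ltNge ltW // andbF. Qed.

(** All four points lie on one side of a coordinate axis, so the quadrilateral cannot wind around
    the origin. *)
Lemma crosses_cell u v w z : `|u - v| < `|u| -> `|u - w| < `|u| -> `|u - z| < `|u| ->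
  xorb (crosses u v) (crosses w z) = xorb (crosses u w) (crosses v z).
Proof.
move=> uv uw uz.
have u0 : u != 0 by rewrite -normr_gt0; apply: le_lt_trans uv.
have uu : `|u - u| < `|u| by rewrite subrr normr0 normr_gt0.
have [S [SP sides]] := close_sides u0.
move: (SP _ uu) (SP _ uv) (SP _ uw) (SP _ uz) => {SP} Su Sv Sw Sz.
case: sides => S1.
- rewrite /crosses !S1 // !andbT.
  by case: (upper_half u); case: (upper_half v); case: (upper_half w); case: (upper_half z).
- by rewrite !crosses_left ?S1.
- by rewrite /crosses !(upper_half_pos (S1 _ _)).
- by rewrite /crosses !(upper_half_neg (S1 _ _)).
Qed.

(** Negation exchanges crossings of the positive and the negative x-axis; together they record
    whether the half-plane changes. *)
Lemma crossesN u v : `|u - v| < `|u| ->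
  crosses (- u) (- v) = xorb (crosses u v) (xorb (upper_half u) (upper_half v)).
Proof.
move=> uv; have u0 : u != 0 by rewrite -normr_gt0; apply: le_lt_trans uv.
have uu : `|u - u| < `|u| by rewrite subrr normr0 normr_gt0.
have [S [SP sides]] := close_sides u0; move: (SP _ uu) (SP _ uv) => {SP} Su Sv.
have v0 : v != 0.
  by apply/eqP => v0; subst v; case: sides => /(_ 0 Sv); rewrite /= ltxx.
rewrite /crosses !upper_halfN // oppr_gt0.
case: sides => S1.
- have u1 := S1 _ Su; rewrite u1 [_ < 0]ltNge ltW //=.
  by case: (upper_half u); case: (upper_half v).
- have u1 := S1 _ Su; rewrite u1 [0 < _]ltNge ltW //=.
  by case: (upper_half u); case: (upper_half v).
- by rewrite !(upper_half_pos (S1 _ _)).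
- by rewrite !(upper_half_neg (S1 _ _)).
Qed.

Fixpoint chain_parity (g : R * R -> R * R -> bool) u (s : seq (R * R)) : bool :=
  if s is v :: s' then xorb (g u v) (chain_parity g v s') else false.

Definition winding (z : R * R) : R * R -> seq (R * R) -> bool :=
  chain_parity (fun u v => crosses (u - z) (v - z)).

Variable e : R.

Definition fine_chain u (s : seq (R * R)) : bool := path (fun v w => `|v - w| < e) u s.

(** The factor 2: when both points of a pair move by less than [e], their difference moves by less
    than [2 * e], which is within reach of [crosses_cell]. *)
Definition far_apart (A B : seq (R * R)) : Prop :=
  forall u v, u \in A -> v \in B -> 2 * e <= `|u - v|.

Lemma winding_row u u' y t : `|u - u'| < e -> fine_chain y t ->
  far_apart [:: u; u'] (y :: t) ->
  xorb (crosses (u - y) (u' - y)) (crosses (u - last y t) (u' - last y t)) =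
  xorb (chain_parity (fun v v' => crosses (u - v) (u - v')) y t)
       (chain_parity (fun v v' => crosses (u' - v) (u' - v')) y t).
Proof.
move=> uu'; elim: t y => [|y' t IH] y /=; first by rewrite Bool.xorb_nilpotent.
move=> /andP[yy' ch] far.
have uy : 2 * e <= `|u - y| by apply: far; rewrite !inE eqxx.
have {}IH : xorb (crosses (u - y') (u' - y')) (crosses (u - last y' t) (u' - last y' t)) =
    xorb (chain_parity (fun v v' => crosses (u - v) (u - v')) y' t)
         (chain_parity (fun v v' => crosses (u' - v) (u' - v')) y' t).
  by apply: IH => // a b aA bB; apply: far => //; rewrite inE bB orbT.
have e0 : 0 < e by exact: le_lt_trans uu'.
have cell : xorb (crosses (u - y) (u' - y)) (crosses (u - y') (u' - y')) =
    xorb (crosses (u - y) (u - y')) (crosses (u' - y) (u' - y')).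
  apply: crosses_cell; apply: lt_le_trans uy.
  - by rewrite opprB addrA subrK; lra.
  - by rewrite opprB addrC addrA subrK distrC; lra.
  - have -> : u - y - (u' - y') = (u - u') - (y - y') 
      by rewrite !opprB addrACA [RHS]addrACA [in RHS](addrC (- u')).
    by have := ler_normB (u - u') (y - y'); move: uu' yy'; lra.
move: IH cell; do 4!case: (crosses _ _) => //=; case: (crosses _ _) => //=;
  do 2!case: (chain_parity _ _ _) => //=.
Qed.

(** A discrete Stokes formula on the grid of pairs of points of the two chains: the boundary sum of
    a cell vanishes by [crosses_cell], interior edges cancel, and the outer edges remain. *)
Lemma winding_grid x s y t : fine_chain x s -> fine_chain y t ->
  far_apart (x :: s) (y :: t) ->
  xorb (winding y x s) (winding (last y t) x s) =
  xorb (chain_parity (fun v v' => crosses (x - v) (x - v')) y t)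
       (chain_parity (fun v v' => crosses (last x s - v) (last x s - v')) y t).
Proof.
move=> + ct; elim: s x => [|x' s IH] x /=; first by rewrite Bool.xorb_nilpotent.
move=> /andP[xx' cs] far.
have row := winding_row xx' ct _.
have {}IH : xorb (winding y x' s) (winding (last y t) x' s) =
  xorb (chain_parity (fun v v' => crosses (x' - v) (x' - v')) y t)
       (chain_parity (fun v v' => crosses (last x' s - v) (last x' s - v')) y t).
  by apply: IH => // a b aA; apply: far; rewrite inE aA orbT.
have {}row : xorb (crosses (x - y) (x' - y)) (crosses (x - last y t) (x' - last y t)) =
  xorb (chain_parity (fun v v' => crosses (x - v) (x - v')) y t)
       (chain_parity (fun v v' => crosses (x' - v) (x' - v')) y t).
  apply: row => a b; rewrite !inE => /orP[]/eqP->; apply: far; rewrite !inE eqxx ?orbT //.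
rewrite /winding /= in IH *.
move: IH row; do 2!case: (crosses _ _) => //=; do 5!case: (chain_parity _ _ _) => //=.
Qed.

(** The corrections of [crossesN] telescope to the two ends of the chain. *)
Lemma chain_parityN x y t : fine_chain y t -> far_apart [:: x] (y :: t) ->
  chain_parity (fun v v' => crosses (x - v) (x - v')) y t =
  xorb (winding x y t) (xorb (upper_half (y - x)) (upper_half (last y t - x))).
Proof.
elim: t y => [|y' t IH] y /=; first by rewrite Bool.xorb_nilpotent.
move=> /andP[yy' ct] far; rewrite {}IH //; last first.
  by move=> a b aA bB; apply: far => //; rewrite inE bB orbT.
rewrite /winding /= -(opprB y x) -(opprB y' x) crossesN; last first.
  rewrite opprB addrA subrK; apply: (lt_le_trans yy').
  have := far x y (mem_head _ _) (mem_head _ _); rewrite distrC.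
  have := normr_ge0 (y - y'); move: yy'; lra.
case: (crosses _ _); case: (chain_parity _ _ _); case: (upper_half _);
  case: (upper_half _); by case: (upper_half _).
Qed.

Lemma far_apart_sub A B A' B' : {subset A' <= A} -> {subset B' <= B} ->
  far_apart A B -> far_apart A' B'.
Proof. by move=> AA BB far u v /AA uA /BB vB; exact: far. Qed.

(* The coboundary relation of the van Kampen obstruction for a pair of
   disjoint chains. *)
Lemma winding_relation x s y t : fine_chain x s -> fine_chain y t ->
  far_apart (x :: s) (y :: t) ->
  xorb (xorb (winding y x s) (winding (last y t) x s))
       (xorb (winding x y t) (winding (last x s) y t)) =
  xorb (xorb (upper_half (y - x)) (upper_half (last y t - x)))
       (xorb (upper_half (y - last x s)) (upper_half (last y t - last x s))).
Proof.
move=> cs ct far; rewrite (winding_grid cs ct far).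
have l_in : {subset [:: last x s] <= x :: s} by move=> a; rewrite inE => /eqP->; exact: mem_last.
have x_in : {subset [:: x] <= x :: s} by move=> a; rewrite !inE => ->.
rewrite !chain_parityN //; do ?[exact: far_apart_sub far].
case: (winding x y t); case: (winding (last x s) y t); do 3!case: (upper_half _);
  by case: (upper_half _).
Qed.

Lemma far_apart_upper_half A B u v : 0 < e -> far_apart A B -> u \in A -> v \in B ->
  upper_half (v - u) = xorb true (upper_half (u - v)).
Proof.
move=> e0 far uA vB; rewrite -opprB upper_halfN //.
by rewrite -normr_gt0; have := far u v uA vB; lra.
Qed.

(** Sum [winding_relation] over the ordered pairs [j != j']. Windings of one [p] about another and
    half-plane terms involving some [p] occur an even number of times, while each of the three pairs
    of points [a] leaves one [true] by antisymmetry. So [S] would take different values at any two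
    of three indices, impossible for booleans. *)
Theorem K33_chains (p a : 'I_3 -> R * R) (s : 'I_3 -> 'I_3 -> seq (R * R)) : 0 < e ->
  (forall i j, fine_chain (p i) (s i j)) -> (forall i j, last (p i) (s i j) = a j) ->
  (forall i i' j j', i != i' -> j != j' -> far_apart (p i :: s i j) (p i' :: s i' j')) ->
  False.
Proof.
move=> e0 ch lst far.
pose o0 := @Ordinal 3 0 isT; pose o1 := @Ordinal 3 1 isT; pose o2 := @Ordinal 3 2 isT.
pose w i j j' := winding (a j') (p i) (s i j).
pose S i := xorb (xorb (xorb (w i o0 o1) (w i o0 o2)) (xorb (w i o1 o0) (w i o1 o2)))
                 (xorb (w i o2 o0) (w i o2 o1)).
have pin i j : p i \in p i :: s i j by rewrite inE eqxx.
have ain i j : a j \in p i :: s i j by rewrite -(lst i j) mem_last.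
suff Sneq i i' : i != i' -> xorb (S i) (S i') = true.
  move: (Sneq o0 o1 isT) (Sneq o0 o2 isT) (Sneq o1 o2 isT).
  by case: (S o0); case: (S o1); case: (S o2).
move=> ii'.
pose q j j' := xorb (xorb (winding (p i') (p i) (s i j)) (w i j j'))
                    (xorb (winding (p i) (p i') (s i' j')) (w i' j' j)).
pose h j j' := xorb (xorb (upper_half (p i' - p i)) (upper_half (a j' - p i)))
   (xorb (xorb true (upper_half (a j - p i'))) (upper_half (a j' - a j))).
have rel j j' : j != j' -> q j j' = h j j'.
  move=> jj'; have f := far _ _ _ _ ii' jj'.
  have := winding_relation (ch i j) (ch i' j') f; rewrite !lst /q /w /h => ->.
  by rewrite (far_apart_upper_half e0 f (ain i j) (pin i' j')).
have anti j j' : j != j' -> upper_half (a j' - a j) = xorb true (upper_half (a j - a j')).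
  move=> jj'; exact: far_apart_upper_half e0 (far i i' j j' ii' jj') (ain i j) (ain i' j').
have : xorb (xorb (xorb (q o0 o1) (q o0 o2)) (xorb (q o1 o0) (q o1 o2)))
            (xorb (q o2 o0) (q o2 o1)) = true.
  rewrite !rel // /h (anti o0 o1) // (anti o0 o2) // (anti o1 o2) //.
  ring.
move=> <-; rewrite /S /q; ring.
Qed.

End VanKampen.

(** * Plane topology *)

Lemma connected_locally_constant (T : topologicalType) (A P : set T) :
  connected A -> (forall z, A z -> \forall w \near z, A w -> (P z <-> P w)) ->
  forall x y, A x -> A y -> P x -> P y.
Proof.
move=> cA loc x y Ax Ay Px; suff AP : A `&` P = A by move: Ay; rewrite -AP => -[].
apply: cA; first by exists x.
  exists [set w | A w -> P w]^°; first exact: open_interior.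
  apply/seteqP; split=> z [Az Pz]; split=> //.
    by apply: filterS (loc z Az) => w zw Aw; apply/(zw Aw).
  exact: (interior_subset Pz).
exists (~` [set w | A w -> ~ P w]^°); first exact/open_closedC/open_interior.
apply/seteqP; split=> z [Az Pz]; split=> //.
  by move=> /interior_subset; apply.
apply: contrapT => nPz; apply: Pz.
by apply: filterS (loc z Az) => w zw Aw Pw; apply: nPz; apply/(zw Aw).
Qed.

Section Plane.
Variable R : realType.
Implicit Types (x y z : R * R) (A B K : set (R * R)).

Lemma near_norm (z : R * R) (e : R) : 0 < e -> \forall w \near z, `|z - w| < e.
Proof. by move=> e0; apply/nbhs_normP; exists e. Qed.

Definition eps_joined A x y : Prop := forall e : R, 0 < e -> exists s,
  [/\ fine_chain e x s, last x s = y & forall u, u \in x :: s -> A u].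

Lemma eps_joined_trans A x y z : eps_joined A x y -> eps_joined A y z -> eps_joined A x z.
Proof.
move=> xy yz e e0; have [s [cs ls As]] := xy e e0; have [t [ct lt At]] := yz e e0.
exists (s ++ t); split; rewrite ?last_cat ?ls //.
  by rewrite /fine_chain cat_path ls; apply/andP.
move=> u; rewrite inE mem_cat => /or3P[/eqP->|us|ut].
- by apply: As; rewrite inE eqxx.
- by apply: As; rewrite inE us orbT.
- by apply: At; rewrite inE ut orbT.
Qed.

Lemma eps_joined_refl A x : A x -> eps_joined A x x.
Proof. by move=> Ax e e0; exists [::]; split=> // u; rewrite inE => /eqP->. Qed.

Lemma eps_joined_sub A B x y : A `<=` B -> eps_joined A x y -> eps_joined B x y.
Proof. by move=> AB xy e /xy[s [? ? h]]; exists s; split=> // u /h /AB. Qed.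

Lemma connected_eps_joined A x y : connected A -> A x -> A y -> eps_joined A x y.
Proof.
move=> cA Ax Ay e e0.
pose P := [set z | exists s, [/\ fine_chain e x s, last x s = z & forall u, u \in x :: s -> A u]].
have step z w : A w -> `|z - w| < e -> P z -> P w.
  move=> Aw zw [s [cs ls As]]; exists (rcons s w).
  split; rewrite ?last_rcons //; first by rewrite /fine_chain rcons_path ls zw andbT.
  move=> u; rewrite inE mem_rcons inE => /or3P[/eqP->|/eqP->|us] //.
  by apply: As; rewrite inE us orbT.
apply: (@connected_locally_constant _ A P) (Ax) _ _ => //; last first.
  by exists [::]; split=> // u; rewrite inE => /eqP->.
move=> z Az; apply: filterS (near_norm z e0) => w zw Aw; split; first exact: step.
by apply: step => //; rewrite distrC.
Qed.

Lemma compact_separated A B : compact A -> compact B -> A `&` B = set0 ->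
  exists2 d : R, 0 < d & forall u v, A u -> B v -> d <= `|u - v|.
Proof.
move=> cA cB AB.
have [->|/set0P[a Aa]] := eqVneq A set0; first by exists 1.
have [->|/set0P[b Bb]] := eqVneq B set0; first by exists 1.
have AB0 : A `*` B !=set0 by exists (a, b).
have cf : {within A `*` B, continuous (fun p : (R * R) * (R * R) => `|p.1 - p.2|)}.
  apply: continuous_subspaceT => p; apply: cvg_norm.
  by apply: cvgB; [exact: cvg_fst|exact: cvg_snd].
have [c] := compact_EVT_min AB0 (compact_setX cA cB) cf.
rewrite inE => -[Ac Bc] cmin; exists `|c.1 - c.2|.
  rewrite normr_gt0 subr_eq0; apply/eqP => c12.
  have : (A `&` B) c.1 by split=> //; rewrite c12.
  by rewrite AB.
by move=> u v Au Bv; apply: (cmin (u, v)); rewrite inE; split.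
Qed.

Definition segment x y : set (R * R) := (fun t : R => x + t *: (y - x)) @` `[0, 1].

Lemma segment_continuous x y : continuous (fun t : R => x + t *: (y - x)).
Proof. by move=> t; apply: cvgD; [exact: cvg_cst|apply: cvgZr_tmp; exact: cvg_id]. Qed.

Lemma compact_segment x y : compact (segment x y).
Proof.
apply: continuous_compact; last exact: segment_compact.
exact/continuous_subspaceT/segment_continuous.
Qed.

Lemma connected_segment x y : connected (segment x y).
Proof.
apply: connected_continuous_connected; first exact: segment_connected.
exact/continuous_subspaceT/segment_continuous.
Qed.

Lemma segmentl x y : segment x y x.
Proof. by exists 0; rewrite ?scale0r ?addr0 //= in_itv /= lexx ler01. Qed.

Lemma segmentr x y : segment x y y.
Proof. by exists 1; rewrite ?scale1r 1?addrC ?subrK //= in_itv /= lexx ler01. Qed.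

Lemma segment_norm x y z : segment x y z -> `|x - z| <= `|x - y|.
Proof.
move=> [t /=]; rewrite in_itv /= => /andP[t0 t1] <-.
rewrite opprD addrA subrr add0r normrN normrZ distrC ger0_norm //.
by rewrite -[leRHS]mul1r ler_wpM2r.
Qed.

(** The outer face is not compact, whereas [compact_separated] needs compact connections inside
    it. *)
Definition compactly_joined (O : set (R * R)) x y : Prop :=
  exists B, [/\ compact B, connected B, B `<=` O, B x & B y].

Lemma compactly_joined_sym O x y : compactly_joined O x y -> compactly_joined O y x.
Proof. by move=> [B []]; exists B. Qed.

Lemma compactly_joined_trans O x y z :
  compactly_joined O x y -> compactly_joined O y z -> compactly_joined O x z.
Proof.
move=> [B [kB cB BO Bx By]] [C [kC cC CO Cy Cz]]; exists (B `|` C); split.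
- exact: compactU.
- by apply: connectedU => //; exists y.
- by rewrite subUset.
- by left.
- by right.
Qed.

Lemma connected_compactly_joined (O A : set (R * R)) x y :
  open O -> A `<=` O -> connected A -> A x -> A y -> compactly_joined O x y.
Proof.
move=> oO AO cA Ax Ay.
apply: (@connected_locally_constant _ A (compactly_joined O x)) (Ax) _ _ => //; last first.
  exists [set x]; split=> //; [exact: compact_set1|exact: connected1|].
  by move=> _ ->; exact: AO.
move=> z Az; have /nbhs_normP[e /= e0 eO] : nbhs z O.
  by apply: open_nbhs_nbhs; split=> //; exact: AO.
apply: filterS (near_norm z e0) => w zw Aw.
have zwO : compactly_joined O z w.
  exists (segment z w); split; [exact: compact_segment|exact: connected_segment| |
    exact: segmentl|exact: segmentr].
  by move=> u /segment_norm zu; apply: eO => /=; exact: le_lt_trans zu zw.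
split=> h; apply: compactly_joined_trans h _ => //; exact: compactly_joined_sym.
Qed.

Lemma bounded_setP A (M : R) : (forall p, A p -> `|p| <= M) -> bounded_set A.
Proof.
move=> AM; exists M; split; first exact: num_real.
by move=> N MN p /AM /le_trans; apply; exact: ltW.
Qed.

Lemma bounded_setE A : bounded_set A -> exists M : R, forall p, A p -> `|p| <= M.
Proof. by move=> [M [_ /(_ (M + 1))]]; rewrite ltrDl ltr01 => /(_ isT); exists (M + 1). Qed.

Lemma convex_connected A : (forall x y, A x -> A y -> segment x y `<=` A) -> connected A.
Proof.
move=> cvx; have [->|/set0P[a Aa]] := eqVneq A set0; first exact: connected0.
have -> : A = \bigcup_(y in A) segment a y.
  apply/seteqP; split=> [y Ay|z [y Ay]]; last exact: cvx.
  by exists y => //; exact: segmentr.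
apply: bigcup_connected => [|y _]; last exact: connected_segment.
by exists a => y _; exact: segmentl.
Qed.

Lemma line_fst x y (t : R) : (x + t *: (y - x)).1 = x.1 + t * (y.1 - x.1).
Proof. by []. Qed.

Lemma line_snd x y (t : R) : (x + t *: (y - x)).2 = x.2 + t * (y.2 - x.2).
Proof. by []. Qed.

(** In the sup norm this set is a union of four half-planes, each convex, which meet in a chain. *)
Lemma connected_far (M : R) : connected [set p : R * R | M < `|p|].
Proof.
have half (f : R * R -> R) : (forall x y t, f (x + t *: (y - x)) = f x + t * (f y - f x)) ->
    connected [set p | M < f p].
  move=> flin; apply: convex_connected => x y /= fx fy z [t /=].
  rewrite in_itv /= => /andP[t0 t1] <-; rewrite /= flin.
  have -> : f x + t * (f y - f x) = (1 - t) * f x + t * f y by lra.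
  have [->|tn1] := eqVneq t 1; first by rewrite subrr mul0r add0r mul1r.
  have : (1 - t) * M < (1 - t) * f x by rewrite ltr_pM2l // subr_gt0 lt_neqAle tn1.
  have : t * M <= t * f y by rewrite ler_wpM2l // ltW.
  lra.
have -> : [set p : R * R | M < `|p|] = ([set p | M < p.1] `|` [set p | M < p.2]) `|`
    ([set p | M < - p.1] `|` [set p | M < - p.2]).
  apply/seteqP; split=> p /=.
    rewrite norm_pairE lt_max !ltr_normr.
    by move=> /orP[/orP[]|/orP[]] h; [left; left|right; left|left; right|right; right].
  rewrite norm_pairE lt_max !ltr_normr.
  by case=> -[] -> /=; rewrite ?orbT.
have big : exists N : R, M < N /\ M < - (- N) by exists (M + 1); rewrite opprK ltrDl ltr01.
have [N [MN MN']] := big.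
apply: connectedU; [exists (N, - N)| |].
- by split; [left|right].
- apply: connectedU; [by exists (N, N); split| |]; apply: half => x y t; rewrite ?line_fst ?line_snd; lra.
- apply: connectedU; [by exists (- N, - N); split| |]; apply: half => x y t; rewrite ?line_fst ?line_snd; lra.
Qed.

End Plane.

(** * Outerplane drawings have no K_{2,3} minor *)

Lemma K33_compact (R : realType) (c a : 'I_3 -> R * R) (S : 'I_3 -> 'I_3 -> set (R * R)) :
  (forall k i, compact (S k i)) -> (forall k i, eps_joined (S k i) (c k) (a i)) ->
  (forall k l i j, k != l -> i != j -> S k i `&` S l j = set0) -> False.
Proof.
move=> cpt joined disj.
have [e [e0 eP]] : exists e : R, 0 < e /\ forall x : ('I_3 * 'I_3) * ('I_3 * 'I_3),
    x.1.1 != x.2.1 -> x.1.2 != x.2.2 ->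
    forall u v, S x.1.1 x.1.2 u -> S x.2.1 x.2.2 v -> 2 * e <= `|u - v|.
  (* Each of the finitely many disjoint pairs only requires [e] to be small, so the right
     neighbourhoods of 0 supply a common value. *)
  have : \forall e \near (0 : R)^'+, 0 < e /\ forall x : ('I_3 * 'I_3) * ('I_3 * 'I_3),
      x.1.1 != x.2.1 -> x.1.2 != x.2.2 ->
      forall u v, S x.1.1 x.1.2 u -> S x.2.1 x.2.2 v -> 2 * e <= `|u - v|.
    apply: filterI; first exact: nbhs_right_gt.
    have FF : Filter (0 : R)^'+ by exact: at_right_proper_filter.
    apply: (@filter_forall R _ (fun (x : ('I_3 * 'I_3) * ('I_3 * 'I_3)) (e : R) =>
      x.1.1 != x.2.1 -> x.1.2 != x.2.2 ->
      forall u v, S x.1.1 x.1.2 u -> S x.2.1 x.2.2 v -> 2 * e <= `|u - v|) _ FF).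
    move=> [[k i] [l j]] /=.
    have [->|kl] := eqVneq k l; first exact: nearW.
    have [->|ij] := eqVneq i j; first by apply: nearW.
    have [d d0 dP] := compact_separated (cpt k i) (cpt l j) (disj _ _ _ _ kl ij).
    have d2 : 0 < d / 2 by rewrite divr_gt0.
    apply: filterS (nbhs_right_lt d2) => e ed _ _ u v Su Sv.
    by apply: le_trans (dP u v Su Sv); move: ed; lra.
  by move=> /filter_ex[e [e0 eP]]; exists e.
have [s sP] := choice (fun x : 'I_3 * 'I_3 => joined x.1 x.2 e e0).
apply: (@K33_chains R e c a (fun k i => s (k, i))) => //.
- by move=> k i; have [] := sP (k, i).
- by move=> k i; have [] := sP (k, i).
- move=> k l i j kl ij u v us vs; apply: (eP ((k, i), (l, j))) => //=.
    by have [_ _] := sP (k, i); apply.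
  by have [_ _] := sP (l, j); apply.
Qed.

Lemma is_arc_compact (R : realType) (A : set (R * R)) p q : is_arc A p q -> compact A.
Proof.
by move=> [f [cf _ _ _ ->]]; apply: continuous_compact => //; exact: segment_compact.
Qed.

Lemma is_arc_eps_joined (R : realType) (A : set (R * R)) p q :
  is_arc A p q -> eps_joined A p q.
Proof.
move=> [f [cf _ f0 f1 AE]]; apply: connected_eps_joined.
- by rewrite AE; apply: connected_continuous_connected => //; exact: segment_connected.
- by rewrite AE -f0; exists 0 => //=; rewrite in_itv /= lexx ler01.
- by rewrite AE -f1; exists 1 => //=; rewrite in_itv /= lexx ler01.
Qed.

Section DrawingOfPart.
Variables (R : realType) (G : sgraph) (d : drawing R G).

Definition drawn (X : G -> Prop) : set (R * R) :=
  [set p | (exists2 x, X x & vpoint d x = p) \/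
           (exists x y, [/\ X x, X y, edge x y & Defs.arc d x y p])].

Lemma drawn_sub X Y : (forall x, X x -> Y x) -> drawn X `<=` drawn Y.
Proof.
move=> XY p [[x /XY Yx px]|[x [y [/XY Yx /XY Yy xy pxy]]]]; first by left; exists x.
by right; exists x, y.
Qed.

Lemma drawn_all : drawn (fun=> True) = drawing_support d.
Proof.
apply/seteqP; split=> p.
  move=> [[x _ px]|[x [y [_ _ xy pxy]]]]; first by left; exists x.
  by right; exists x, y.
move=> [[x _ px]|[x [y [xy pxy]]]]; first by left; exists x.
by right; exists x, y.
Qed.

Lemma drawn_vertex (X : G -> Prop) x : drawn X (vpoint d x) -> X x.
Proof.
move=> [[y Xy /vpoint_inj <-]|[y [z [Xy Xz yz xyz]]]] //.
by have [->|->] := arc_vpoint yz xyz.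
Qed.

Lemma compact_drawn X : compact (drawn X).
Proof.
have -> : drawn X = \big[setU/set0]_(x <- enum G | `[< X x >]) [set vpoint d x] `|`
    \big[setU/set0]_(e <- enum {: G * G} | `[< X e.1 /\ X e.2 /\ edge e.1 e.2 >]) Defs.arc d e.1 e.2.
  rewrite -!bigcup_seq_cond; apply/seteqP; split=> p.
    move=> [[x Xx <-]|[x [y [Xx Xy xy pxy]]]].
      by left; exists x => //=; rewrite mem_enum; apply/asboolP.
    by right; exists (x, y) => //=; rewrite mem_enum; apply/asboolP.
  move=> [[x /= /andP[_ /asboolP Xx] ->]|[[x y] /= /andP[_ /asboolP[Xx [Xy xy]]] pxy]].
    by left; exists x.
  by right; exists x, y.
apply: compactU; apply: bigsetU_compact; first by move=> x _; exact: compact_set1.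
by move=> x /asboolP[_ [_ xy]]; exact: is_arc_compact (arcP d xy).
Qed.

Lemma closed_drawn X : closed (drawn X).
Proof.
apply: compact_closed (@compact_drawn X).
exact: (@norm_hausdorff _ (R * R)%type).
Qed.

Lemma drawn_eps_joined X x y : conn (@adjacent G) X x y ->
  eps_joined (drawn X) (vpoint d x) (vpoint d y).
Proof.
elim=> [Xx|u v xu xu' uv Xv]; first by apply: eps_joined_refl; left; exists x.
apply: eps_joined_trans xu' _; have Xu := conn_memr xu.
by apply: eps_joined_sub (is_arc_eps_joined (arcP d uv)) => p uvp; right; exists u, v.
Qed.

Lemma drawn_disjoint (X Y : G -> Prop) :
  (forall x, X x -> ~ Y x) -> drawn X `&` drawn Y = set0.
Proof.
move=> XY; apply/seteqP; split=> // p [Xp Yp].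
have vX z : vpoint d z = p -> False.
  by move=> zp; subst p; exact: XY (drawn_vertex Xp) (drawn_vertex Yp).
case: Xp => [[x _ /vX//]|[x [y [Xx Xy xy pxy]]]].
case: Yp => [[z _ /vX//]|[z [t [Yz Yt zt pzt]]]].
have [z' _ /vX//] : range (vpoint d) p.
apply: (arc_disjoint xy zt) => //.
  by move=> [xz _]; subst z; exact: XY Xx Yz.
by move=> [xt _]; subst t; exact: XY Xx Yt.
Qed.

Lemma open_complement_support : open (~` drawing_support d).
Proof.
by rewrite -drawn_all; apply/closed_openC/closed_drawn.
Qed.

(** The support is bounded, and every unbounded component of its complement reaches the connected
    outside of a large ball. *)
Lemma outer_face_connected z z' : outer_face d z -> outer_face d z' ->
  connected_component (~` drawing_support d) z z'.
Proof.
have [M KM] : exists M : R, forall p, drawing_support d p -> `|p| <= M.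
  by apply/bounded_setE/compact_bounded; rewrite -drawn_all; exact: compact_drawn.
have far u : outer_face d u -> exists2 w,
    connected_component (~` drawing_support d) u w & M < `|w|.
  move=> uf; apply: contrapT => h; apply: uf; apply: (@bounded_setP _ _ M) => p up.
  by rewrite leNgt; apply/negP => Mp; apply: h; exists p.
move=> /far[w zw Mw] /far[w' zw' Mw'].
apply: connected_component_trans zw _.
apply: connected_component_trans (connected_component_sym zw').
exists [set p | M < `|p|] => //; split=> //; last exact: connected_far.
by move=> p /= Mp Kp; have := KM p Kp; rewrite leNgt Mp.
Qed.

Hypothesis outer : forall x, boundary (outer_face d) (vpoint d x).

(* A point of the outer face, joined inside it to the drawings of three branch
   vertices, is a third hub and would complete K_{2,3} to K_{3,3}. *)
Lemma drawing_K23_minor_free : K23_minor_free (@adjacent G).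
Proof.
move=> P Q A cP cQ cA PQ dA AA tP tQ.
have [p Pp] : exists p, P p by have [p [_ [Pp _ _]]] := tP ord0; exists p.
have [q Qq] : exists q, Q q by have [q [_ [Qq _ _]]] := tQ ord0; exists q.
have [a aA] : {a : 'I_3 -> G & forall i, A i (a i)}.
  by apply: choice => i; have [_ [x [_ Ax _]]] := tP i; exists x.
have hub (B : G -> Prop) b i : connected_in (@adjacent G) B -> B b ->
    touches (@adjacent G) B (A i) ->
    conn (@adjacent G) (fun x => B x \/ A i x) b (a i).
  move=> cB Bb [x [y [Bx Ay xy]]].
  apply: (@conn_trans _ _ _ _ x).
    by apply: conn_sub (cB b x Bb Bx) => z bz; left; exact: conn_memr bz.
  apply: (@conn_trans _ _ _ _ y); first by apply: conn_edge => //; [left|right].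
  by apply: conn_sub (cA i y (a i) Ay (aA i)) => z bz; right; exact: conn_memr bz.
(* The segment from [z i] to [a i] may cross the drawing of [A i] and edges leaving [A i]: it only
   has to avoid sets [S l j] with [j != i], which are drawn without vertices of [A i]. *)
have [z zP] : {z : 'I_3 -> R * R & forall i, outer_face d (z i) /\
    forall w, segment (z i) (vpoint d (a i)) w -> ~ drawn (fun x => ~ A i x) w}.
  apply: (@choice _ _ (fun i z => outer_face d z /\
    forall w, segment z (vpoint d (a i)) w -> ~ drawn (fun x => ~ A i x) w)) => i.
  have oF : open (~` drawn (fun x => ~ A i x)).
    exact/closed_openC/closed_drawn.
  have /nbhs_normP[e /= e0 eF] : nbhs (vpoint d (a i)) (~` drawn (fun x => ~ A i x)).
    by apply: open_nbhs_nbhs; split=> // /drawn_vertex; apply.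
  have [ca _] := outer (a i).
  have [z [zo /= ze]] := ca _ (near_norm (vpoint d (a i)) e0).
  exists z; split=> // w [t /=]; rewrite in_itv /= => /andP[t0 t1] <-.
  apply: eF => /=; apply: le_lt_trans ze.
  have -> : vpoint d (a i) - (z + t *: (vpoint d (a i) - z)) =
      (1 - t) *: (vpoint d (a i) - z) by rewrite scalerBl scale1r opprD addrA.
  by rewrite normrZ ger0_norm ?subr_ge0 // -[leRHS]mul1r ler_wpM2r // gerBl.
have [B BP] : {B : 'I_3 -> set (R * R) & forall i, [/\ compact (B i), connected (B i),
    B i `<=` ~` drawing_support d, B i (z ord0) & B i (z i)]}.
  apply: (@choice _ _ (fun i B => [/\ compact B, connected B,
    B `<=` ~` drawing_support d, B (z ord0) & B (z i)])) => i.
  have z0i := outer_face_connected (zP ord0).1 (zP i).1.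
  have Oz0 := connected_component_sub (connected_component_sym z0i).
  apply: (@connected_compactly_joined _ _ (connected_component (~` drawing_support d) (z ord0))) z0i.
  - exact: open_complement_support.
  - exact: connected_component_sub.
  - exact: component_connected.
  - exact: connected_component_refl.
pose c (k : 'I_3) := match val k with 0%N => vpoint d p | 1%N => vpoint d q | _ => z ord0 end.
pose S (k i : 'I_3) := match val k with
  | 0%N => drawn (fun x => P x \/ A i x) | 1%N => drawn (fun x => Q x \/ A i x)
  | _ => B i `|` segment (z i) (vpoint d (a i)) end.
have SPQ i j : i != j ->
    drawn (fun x => P x \/ A i x) `&` drawn (fun x => Q x \/ A j x) = set0.
  move=> ij; apply: drawn_disjoint => x [Px|Ax] [Qx|Ax'].
  - exact: PQ Px Qx.
  - by have [] := dA j x Ax'.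
  - by have [] := dA i x Ax.
  - by move/eqP: ij; apply; exact: AA Ax Ax'.
have Sz i j (X : G -> Prop) : i != j -> (forall x, X x -> ~ A i x) ->
    (B i `|` segment (z i) (vpoint d (a i))) `&` drawn X = set0.
  move=> ij XA; apply/seteqP; split=> // w [[Bw|sw] Xw].
    have [_ _ BO _ _] := BP i; apply: (BO w Bw); rewrite -drawn_all.
    exact: drawn_sub Xw.
  by apply: ((zP i).2 w sw); exact: drawn_sub Xw.
have notA i j x : i != j -> P x \/ A j x \/ Q x -> ~ A i x.
  move=> ij + Ax; have [nP nQ] := dA i x Ax => -[//|[Ax'|//]].
  by move/eqP: ij; apply; exact: AA Ax Ax'.
apply: (@K33_compact R c (fun i => vpoint d (a i)) S).
- move=> [[|[|[|//]]] k3] i; rewrite /S /=; [exact: compact_drawn|exact: compact_drawn|].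
  by apply: compactU; [have [] := BP i|exact: compact_segment].
- move=> [[|[|[|//]]] k3] i; rewrite /S /c /=.
  + by apply/drawn_eps_joined/hub.
  + by apply/drawn_eps_joined/hub.
  + have [_ cB _ B0 Bi] := BP i; apply: (@eps_joined_trans _ _ _ (z i)).
      by apply: eps_joined_sub (connected_eps_joined cB B0 Bi) => w; left.
    apply: (@eps_joined_sub _ (segment (z i) (vpoint d (a i)))); first by move=> w; right.
    by apply: connected_eps_joined; [exact: connected_segment|exact: segmentl|exact: segmentr].
- move=> [[|[|[|//]]] k3] [[|[|[|//]]] l3] i j // _ ij; rewrite /S /=.
  + exact: SPQ.
  + rewrite setIC; apply: Sz; first by rewrite eq_sym; exact: ij.
    by move=> x h; apply: (notA _ i) => //; [rewrite eq_sym|case: h; [left|right; left]].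
  + by rewrite setIC; apply: SPQ; rewrite eq_sym.
  + rewrite setIC; apply: Sz; first by rewrite eq_sym; exact: ij.
    by move=> x h; apply: (notA _ i) => //; [rewrite eq_sym|case: h; [right; right|right; left]].
  + apply: Sz; first exact: ij.
    by move=> x h; apply: (notA _ j) => //; case: h; [left|right; left].
  + apply: Sz; first exact: ij.
    by move=> x h; apply: (notA _ j) => //; case: h; [right; right|right; left].
Qed.

End DrawingOfPart.

End Geometry.

From mathcomp Require Import ring.

(** * Drawings with vertices on a parabola *)

Section Parabola.
Local Open Scope classical_set_scope.
Local Open Scope ring_scope.

Variable R : realType.

Lemma segment_sym (x y : R * R) : segment x y = segment y x.
Proof.
suff sub (u v : R * R) : segment u v `<=` segment v u by apply/seteqP; split; exact: sub.
move=> z [t /=]; rewrite in_itv /= => /andP[t0 t1] <-; exists (1 - t).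
  by rewrite /= in_itv /=; apply/andP; split; lra.
have -> : u = (u.1, u.2) by case: u.
have -> : v = (v.1, v.2) by case: v.
apply/eqP; rewrite xpair_eqE; apply/andP; split; apply/eqP; rewrite /= /GRing.scale /=; ring.
Qed.

Lemma is_arc_segment (x y : R * R) : x != y -> is_arc (segment x y) x y.
Proof.
move=> xy; exists (fun t : R => x + t *: (y - x)); split=> //.
- exact/continuous_subspaceT/segment_continuous.
- move=> s t _ _ /addrI /eqP; rewrite -subr_eq0 -scalerBl scaler_eq0 !subr_eq0.
  by rewrite [y == x]eq_sym (negbTE xy) orbF => /eqP.
- by rewrite scale0r addr0.
- by rewrite scale1r addrC subrK.
Qed.

Definition parabola_point (i : nat) : R * R := (i%:R, i%:R ^+ 2).

Lemma parabola_point_inj : injective parabola_point.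
Proof. by move=> i j [/eqP]; rewrite eqr_nat => /eqP. Qed.

(** On a chord the height above the parabola is a quadratic in the abscissa vanishing at both ends,
    so a common point of two chords is an equality of two such quadratics. *)
Lemma chord i j p : segment (parabola_point i) (parabola_point j) p ->
  p.1 ^+ 2 - p.2 = (p.1 - i%:R) * (p.1 - j%:R) /\ (p.1 - i%:R) * (p.1 - j%:R) <= 0.
Proof.
move=> [t /=]; rewrite in_itv /= => /andP[t0 t1] <-; rewrite line_fst line_snd /=.
set a : R := i%:R; set b : R := j%:R; split; first by ring.
have -> : (a + t * (b - a) - a) * (a + t * (b - a) - b) =
    - (t * (1 - t) * (b - a) ^+ 2) by ring.
by rewrite oppr_le0 mulr_ge0 ?sqr_ge0 // mulr_ge0 // subr_ge0.
Qed.

Lemma chord_on_parabola i j p : segment (parabola_point i) (parabola_point j) p ->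
  p.1 ^+ 2 - p.2 = 0 -> p = parabola_point i \/ p = parabola_point j.
Proof.
case: p => x y /chord[/= xy _] h; have yE : y = x ^+ 2 by apply/eqP; rewrite eq_sym -subr_eq0 h.
move: h => /eqP; rewrite xy mulf_eq0 !subr_eq0 => /orP[]/eqP xE; rewrite yE xE.
  by left.
by right.
Qed.

Lemma nested_chords (a b c d x : R) : a <= c -> d <= b -> c < x -> x < d ->
  (x - a) * (x - b) = (x - c) * (x - d) -> a = c /\ b = d.
Proof.
move=> ac db cx xd h.
(* The difference of the two quadratics, written as a sum of two nonnegative products. *)
have h1 : (c - a) * (b - x) + (x - c) * (b - d) = 0 by move: h; nra.
have p1 : 0 <= (c - a) * (b - x) by apply: mulr_ge0; lra.
have p2 : 0 <= (x - c) * (b - d) by apply: mulr_ge0; lra.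
have /eqP : (c - a) * (b - x) = 0 by lra.
have /eqP : (x - c) * (b - d) = 0 by lra.
by rewrite !mulf_eq0 => /orP[] /eqP ? /orP[] /eqP ?; split; lra.
Qed.

Lemma between (a b x : R) : a < b -> (x - a) * (x - b) < 0 -> a < x /\ x < b.
Proof.
move=> ab h; split; rewrite ltNge; apply/negP => h'.
  have : 0 <= (a - x) * (b - x) by apply: mulr_ge0; lra.
  by move: h; nra.
have : 0 <= (x - a) * (x - b) by apply: mulr_ge0; lra.
lra.
Qed.

Section Drawing.
Variables (n : nat) (e : rel 'I_n) (es : symmetric e) (ei : irreflexive e).
Hypothesis noncrossing : forall i j k l : 'I_n,
  e i j -> e k l -> ~~ [&& (i < k)%N, (k < j)%N & (j < l)%N].

Let G := SGraph es ei.
Let pt (i : G) : R * R := parabola_point (val i).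
Let ch (i j : G) : set (R * R) := segment (pt i) (pt j).

Let pt_inj : injective pt. Proof. by move=> i j /parabola_point_inj /val_inj. Qed.

Let pt_neq (x y : G) : edge x y -> pt x != pt y.
Proof. by move=> xy; apply/eqP => /pt_inj E; move: xy; rewrite E edge_irrefl. Qed.

Let ch_pt (x y z : G) : edge x y -> ch x y (pt z) -> z = x \/ z = y.
Proof.
move=> _ /chord_on_parabola; rewrite /= subrr => /(_ erefl).
by case=> /parabola_point_inj /val_inj; [left|right].
Qed.

(** Chords meeting off the parabola have overlapping intervals of abscissas. [noncrossing] makes the
    intervals nested, and [nested_chords] makes them equal. *)
Let ch_disjoint_lt (x y u v : G) p : edge x y -> edge u v -> (val x < val y)%N ->
  (val u < val v)%N -> ~ (x = u /\ y = v) -> ch x y p -> ch u v p -> range pt p.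
Proof.
move=> xy uv ltxy ltuv neq cxy cuv.
have [h1 h2] := chord cxy; have [h3 h4] := chord cuv.
have [h0|h0] := eqVneq (p.1 ^+ 2 - p.2) 0.
  by case: (chord_on_parabola cxy h0) => ->; [exists x|exists y].
exfalso; move: neq; apply.
have neg1 : (p.1 - (val x)%:R) * (p.1 - (val y)%:R) < 0 by rewrite lt_neqAle h2 -h1 h0.
have neg2 : (p.1 - (val u)%:R) * (p.1 - (val v)%:R) < 0 by rewrite lt_neqAle h4 -h3 h0.
have eqn := etrans (esym h1) h3.
rewrite -(ltr_nat R) in ltxy; rewrite -(ltr_nat R) in ltuv.
have [xp py] := between ltxy neg1; have [up pv] := between ltuv neg2.
have uy : (val u < val y)%N by rewrite -(ltr_nat R); lra.
have xv : (val x < val v)%N by rewrite -(ltr_nat R); lra.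
have natE (i j : nat) : i%:R = j%:R :> R -> i = j.
  by move=> /eqP; rewrite eqr_nat => /eqP.
have in_uv : (val x <= val u)%N -> (val v <= val y)%N -> val x = val u /\ val y = val v.
  move=> xu vy; have [] := @nested_chords (val x)%:R (val y)%:R (val u)%:R (val v)%:R p.1;
    rewrite ?ler_nat //; by move=> /natE ? /natE.
have in_xy : (val u <= val x)%N -> (val y <= val v)%N -> val u = val x /\ val v = val y.
  move=> ux yv; have [] := @nested_chords (val u)%:R (val v)%:R (val x)%:R (val y)%:R p.1;
    rewrite ?ler_nat //; by move=> /natE ? /natE.
have c1 := noncrossing xy uv; have c2 := noncrossing uv xy.
have [[? ?]|[? ?]] : (val x = val u /\ val y = val v) \/ (val u = val x /\ val v = val y).
  by case: (ltngtP (val x) (val u)) in_uv in_xy c1 c2 => ?;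
     case: (ltngtP (val y) (val v)) => ?; rewrite ?uy ?xv //=;
     by move=> A B C D; first [left; exact: A|right; exact: B].
  by split; exact: val_inj.
by split; apply: val_inj.
Qed.

Let ch_disjoint (x y u v : G) : edge x y -> edge u v ->
  ~ (x = u /\ y = v) -> ~ (x = v /\ y = u) -> ch x y `&` ch u v `<=` range pt.
Proof.
move=> xy uv n1 n2 p [cxy cuv].
have flip (a b : G) : ch a b p -> ch b a p by rewrite /ch segment_sym.
have neq (a b : G) : edge a b -> (val a < val b)%N \/ (val b < val a)%N.
  move=> ab; case: (ltngtP (val a) (val b)) => [? | ? | /val_inj E]; [by left|by right|].
  by move: ab; rewrite E edge_irrefl.
have [lxy|lxy] := neq _ _ xy; have [luv|luv] := neq _ _ uv.
- exact: (ch_disjoint_lt xy uv).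
- by apply: (@ch_disjoint_lt x y v u) => //; [rewrite edge_sym|exact: flip].
- apply: (@ch_disjoint_lt y x u v) => //; [by rewrite edge_sym| |exact: flip].
  by move=> [yu xv]; apply: n2.
- apply: (@ch_disjoint_lt y x v u) => //; [by rewrite edge_sym|by rewrite edge_sym| |exact: flip|exact: flip].
  by move=> [yv xu]; apply: n1.
Qed.

Definition parabola_drawing : drawing R G :=
  @Drawing R G pt ch pt_inj (fun x y xy => is_arc_segment (pt_neq xy))
    (fun x y _ => segment_sym (pt x) (pt y)) ch_pt ch_disjoint.

Lemma parabola_support p : drawing_support parabola_drawing p -> p.1 ^+ 2 <= p.2.
Proof.
move=> [[x _ <-]|[x [y [_ /chord[h1 h2]]]]]; first by rewrite /= lexx.
by rewrite -subr_le0 h1.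
Qed.

(** The support lies on or above the parabola, so the vertical ray going down from [p] avoids it. *)
Lemma below_outer_face (p : R * R) : p.2 < p.1 ^+ 2 -> outer_face parabola_drawing p.
Proof.
move=> pb /bounded_setE[M CM].
pose V := [set q : R * R | q.1 = p.1 /\ q.2 < p.1 ^+ 2].
have VC : V `<=` connected_component (~` drawing_support parabola_drawing) p.
  apply: connected_component_max; first by [].
    by move=> q [q1 q2] /parabola_support; rewrite q1 leNgt q2.
  apply: convex_connected => x y [x1 x2] [y1 y2] z [t /=].
  rewrite in_itv /= => /andP[t0 t1] <-; split.
    by rewrite line_fst x1 y1 subrr mulr0 addr0.
  rewrite line_snd; set N := p.1 ^+ 2 in x2 y2 *.
  by case: (leP x.2 y.2) => xy; nra.
have [N NE] : exists N, N = p.2 - `|p.2| - `|M| - 1 by eexists.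
have : V (p.1, N).
  split=> //=; apply: le_lt_trans pb; rewrite NE.
  have := normr_ge0 p.2; have := normr_ge0 M; lra.
move=> /VC /CM; rewrite norm_pairE /= ge_max => /andP[_].
have : `|M| + 1 <= `|N|.
  rewrite -[`|N|]normrN; apply: le_trans (ler_norm _); rewrite NE.
  have := ler_norm p.2; lra.
by move=> h1 h2; have := ler_norm M; lra.
Qed.

Lemma noncrossing_outerplanar : outerplanar R G.
Proof.
exists parabola_drawing => x; split.
  move=> B /nbhs_normP[r /= r0 rB].
  exists (pt x - (0, r / 2)); split.
    by apply: below_outer_face; rewrite /= subr0 gtrBl divr_gt0.
  apply: rB => /=; rewrite opprB addrC subrK norm_pairE /= normr0.
  by rewrite gt_max r0 gtr0_norm ?divr_gt0 //; lra.
(* A vertex is in the support, so its component in the complement is empty, hence bounded. *)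
move=> /interior_subset; apply; rewrite connected_component_out.
  by apply: (@bounded_setP _ _ 0).
by apply; left; exists x.
Qed.

End Drawing.
End Parabola.

Lemma G4_outerplanar (R : realType) : outerplanar R G4.
Proof.
apply: noncrossing_outerplanar => i j k l ij kl.
have h : all (fun i => all (fun k => all (fun j => all (fun l =>
    ~~ [&& i < k, k < j & j < l]) (nth [::] G4_nbrs k)) (nth [::] G4_nbrs i))
  (iota 0 23)) (iota 0 23) by vm_compute.
have := allP h i; rewrite mem_iota ltn_ord => /(_ isT)/allP/(_ (val k)).
by rewrite mem_iota ltn_ord => /(_ isT)/allP/(_ _ ij)/allP; exact.
Qed.

Theorem mainTheorem6 (R : realType) :
  (forall G : sgraph, outerplanar R G ->
     (chromatic_number (exact_distance_graph G 3 isT) <= 10)%N) /\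
  (exists G4 : sgraph, outerplanar R G4 /\
     chromatic_number (exact_distance_graph G4 3 isT) = 5%N).
Proof.
split=> [G [d outer]|].
  have adj_sym (x y : G) : adjacent x y -> adjacent y x.
    by rewrite /adjacent edge_sym.
  have [c cP] := exactly3_coloring adj_sym (drawing_K23_minor_free outer).
  apply/chromatic_number_le/colorableP; exists c => x y /at_distance3P.
  exact: cP.
by exists G4; split; [exact: G4_outerplanar|exact: G4_chromatic].
Qed.
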